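(* The parametrized family $D_{2\alpha}^{(\alpha,\alpha)}$, $\alpha\ge 0$, is a family of symmetric divergences on $\mathscr{PC}_2(\mathcal{H})$: for every $\alpha\ge0$ and all $(A+\gamma I),(B+\mu I)\in\mathscr{PC}_2(\mathcal{H})$, $$D_{2\alpha}^{(\alpha,\alpha)}[(A+\gamma I),(B+\mu I)]\ge 0,\ \text{with equality if and only if } A=B \text{ and } \gamma=\mu,$$ $$D_{2\alpha}^{(\alpha,\alpha)}[(A+\gamma I),(B+\mu I)]=D_{2\alpha}^{(\alpha,\alpha)}[(B+\mu I),(A+\gamma I)].$$ The case $\alpha=0$ corresponds to the infinite-dimensional affine-invariant Riemannian distance, $D_0^{(0,0)}=\frac12 d_{\mathrm{aiHS}}^2$, and the case $\alpha=1/2$ corresponds to the infinite-dimensional symmetric Stein divergence $S$, with $S=\frac14 D_1^{(1/2,1/2)}$.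
   Context: $\mathcal{H}$ is a real separable Hilbert space with $\dim\mathcal{H}=\infty$, $I$ its identity operator; $\mathrm{Tr}(\mathcal{H})$ and $\mathrm{HS}(\mathcal{H})$ are the trace class and Hilbert-Schmidt operators. $\mathrm{Tr}_X(\mathcal{H})=\{A+\gamma I: A\in\mathrm{Tr}(\mathcal{H}),\gamma\in\mathbb{R}\}$, $\mathrm{HS}_X(\mathcal{H})=\{A+\gamma I:A\in\mathrm{HS}(\mathcal{H}),\gamma\in\mathbb{R}\}$, with extended Hilbert-Schmidt norm $\|A+\gamma I\|_{\mathrm{eHS}}^2=\|A\|_{\mathrm{HS}}^2+\gamma^2$. An operator $T$ is positive definite, $T>0$, if $T=T^*$ and there is $M>0$ with $\langle x,Tx\rangle\ge M\|x\|^2$ for all $x$. $\mathscr{PC}_2(\mathcal{H})=\{A+\gamma I>0: A=A^*,A\in\mathrm{HS}(\mathcal{H}),\gamma\in\mathbb{R}\}$ (necessarily $\gamma>0$). For $P\in\mathscr{PC}_2(\mathcal{H})$, $\log P\in\mathrm{HS}_X(\mathcal{H})$ is defined by the spectral calculus and $P^s=\exp(s\log P)$, $s\in\mathbb{R}$. Extended Fredholm determinant: for $A+\gamma I\in\mathrm{Tr}_X(\mathcal{H})$, $\gamma\ne0$, $\det_X(A+\gamma I)=\gamma\det(A/\gamma+I)$, with $\det$ the Fredholm determinant. For $\alpha,\beta>0$, $r\neq0$, and $(A+\gamma I),(B+\mu I)\in\mathscr{PC}_2(\mathcal{H})$, $$D_r^{(\alpha,\beta)}[(A+\gamma I),(B+\mu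 I)]=\frac{1}{\alpha\beta}\log\left[\left(\frac{\gamma}{\mu}\right)^{r(\delta-\frac{\alpha}{\alpha+\beta})}\det{}_X\left(\frac{\alpha(\Lambda+\frac{\gamma}{\mu}I)^{r(1-\delta)}+\beta(\Lambda+\frac{\gamma}{\mu}I)^{-r\delta}}{\alpha+\beta}\right)\right],$$ where $\Lambda+\frac{\gamma}{\mu}I=(B+\mu I)^{-1/2}(A+\gamma I)(B+\mu I)^{-1/2}$, $\Lambda\in\mathrm{HS}(\mathcal{H})$, and $\delta=\frac{\alpha\gamma^r}{\alpha\gamma^r+\beta\mu^r}$ (the operator inside $\det_X$ belongs to $\mathrm{Tr}_X(\mathcal{H})$). For $\alpha=0$ the member of the family is defined as the limit $D_0^{(0,0)}[\cdot,\cdot]=\lim_{\alpha\to0^+}D_{2\alpha}^{(\alpha,\alpha)}[\cdot,\cdot]$. $d_{\mathrm{aiHS}}[(A+\gamma I),(B+\mu I)]=\|\log[(B+\mu I)^{-1/2}(A+\gamma I)(B+\mu I)^{-1/2}]\|_{\mathrm{eHS}}$. The infinite-dimensional symmetric Stein divergence is $$S[(A+\gamma I),(B+\mu I)]=\log\left[\left(\frac{\gamma}{\mu}\right)^{\delta-\frac12}\det{}_X\left(\frac{(\Lambda+\frac{\gamma}{\mu}I)^{1-\delta}+(\Lambda+\frac{\gamma}{\mu}I)^{-\delta}}{2}\right)\right],\quad \delta=\frac{\gamma}{\gamma+\mu}.$$ *)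

(* Defs.v *)
From HB Require Import structures.
From mathcomp Require Import all_boot all_order all_algebra.
From mathcomp Require Import all_classical all_reals all_analysis.
Import Order.TTheory GRing.Theory Num.Theory.
Import numFieldNormedType.Exports.

Set Implicit Arguments.
Unset Strict Implicit.
Unset Printing Implicit Defensive.

Local Open Scope classical_set_scope.
Local Open Scope ring_scope.

HB.mixin Record CompleteNormedModule_isHilbert (R : realType) H
    of CompleteNormedModule R H := {
  hdot : H -> H -> R ;
  hdotC : forall x y, hdot x y = hdot y x ;
  hdot_linearr : forall x a y z, hdot x (a *: y + z) = a * hdot x y + hdot x z ;
  hdot_norm : forall x, hdot x x = `|x| ^+ 2 }.

#[short(type="realHilbertType")]
HB.structure Definition RealHilbert (R : realType) :=
  {H of CompleteNormedModule_isHilbert R H & CompleteNormedModule R H}.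

Definition separable_space (T : topologicalType) : Prop :=
  exists2 D : set T, countable D & dense D.

Definition infinite_dimensional (R : realType) (H : realHilbertType R) : Prop :=
  forall (n : nat) (v : 'I_n -> H),
    exists x : H, forall c : 'I_n -> R, x <> \sum_i c i *: v i.

(* Orthonormal bases are indexed by nat, as is always possible in a separable
   infinite-dimensional space. *)
Definition orthonormal_basis (R : realType) (H : realHilbertType R)
    (e : nat -> H) : Prop :=
  (forall i j, hdot (e i) (e j) = (i == j)%:R) /\
  (forall x, series (fun k => hdot (e k) x *: e k) @ \oo --> x).

(* A fixed orthonormal basis; the Hilbert-Schmidt norm, the trace class and the
   Fredholm determinant do not depend on which one is fixed. *)
Definition onb (R : realType) (H : realHilbertType R) : nat -> H :=
  get [set e : nat -> H | orthonormal_basis e].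

Definition bounded_operator (R : realType) (H : realHilbertType R)
    (A : H -> H) : Prop :=
  linear A /\ continuous A.

Definition self_adjoint (R : realType) (H : realHilbertType R)
    (A : H -> H) : Prop :=
  forall x y, hdot (A x) y = hdot x (A y).

(* A + g I *)
Definition plus_scalar (R : realType) (H : realHilbertType R)
    (A : H -> H) (g : R) : H -> H :=
  fun x => A x + g *: x.

Definition hilbert_schmidt (R : realType) (H : realHilbertType R)
    (A : H -> H) : Prop :=
  bounded_operator A /\ cvgn (series (fun k => `|A (onb H k)| ^+ 2)).

Definition hs_norm (R : realType) (H : realHilbertType R) (A : H -> H) : R :=
  Num.sqrt (limn (series (fun k => `|A (onb H k)| ^+ 2))).

(* B is |A|, the positive square root of A^* A. *)
Definition is_absolute_value (R : realType) (H : realHilbertType R)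
    (A B : H -> H) : Prop :=
  [/\ bounded_operator B, self_adjoint B, forall x, 0 <= hdot x (B x) &
      forall x y, hdot (B (B x)) y = hdot (A x) (A y)].

Definition trace_class (R : realType) (H : realHilbertType R)
    (A : H -> H) : Prop :=
  bounded_operator A /\
  exists2 B, is_absolute_value A B &
    cvgn (series (fun k => hdot (onb H k) (B (onb H k)))).

(* det (I + A) for A of trace class, as the limit of the determinants of the
   sections P_n (I + A) P_n, P_n the projection on the first n basis vectors;
   A need not be self-adjoint. *)
Definition fredholm_det (R : realType) (H : realHilbertType R)
    (A : H -> H) : R :=
  limn (fun n => \det (\matrix_(i < n, j < n)
    ((i == j)%:R + hdot (onb H i) (A (onb H j))))).

(* The g for which T - g I is trace class: unique, as dim H is infinite. *)
Definition tr_scalar_part (R : realType) (H : realHilbertType R)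
    (T : H -> H) : R :=
  get [set g : R | trace_class (plus_scalar T (- g))].

Definition detX (R : realType) (H : realHilbertType R) (T : H -> H) : R :=
  let g := tr_scalar_part T in
  g * fredholm_det (fun x => g^-1 *: plus_scalar T (- g) x).

(* The g for which T - g I is Hilbert-Schmidt: unique, as dim H is infinite. *)
Definition hs_scalar_part (R : realType) (H : realHilbertType R)
    (T : H -> H) : R :=
  get [set g : R | hilbert_schmidt (plus_scalar T (- g))].

Definition ehs_norm (R : realType) (H : realHilbertType R) (T : H -> H) : R :=
  let g := hs_scalar_part T in
  Num.sqrt (hs_norm (plus_scalar T (- g)) ^+ 2 + g ^+ 2).

Definition positive_definite (R : realType) (H : realHilbertType R)
    (T : H -> H) : Prop :=
  self_adjoint T /\
  exists2 M : R, 0 < M & forall x, M * `|x| ^+ 2 <= hdot x (T x).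

(* A + g I belongs to PC_2(H); an element of PC_2(H) is represented by the pair
   (A, g), which it determines since dim H is infinite. *)
Definition PC2 (R : realType) (H : realHilbertType R)
    (A : H -> H) (g : R) : Prop :=
  [/\ hilbert_schmidt A, self_adjoint A & positive_definite (plus_scalar A g)].

(* An orthonormal basis of eigenvectors together with the eigenvalues. One
   exists for T = A + g I with A compact and self-adjoint. *)
Definition eigenbasis (R : realType) (H : realHilbertType R)
    (T : H -> H) (p : (nat -> H) * (nat -> R)) : Prop :=
  orthonormal_basis p.1 /\ forall k, T (p.1 k) = p.2 k *: p.1 k.

(* f(T) x = sum_k f(l_k) <e_k, x> e_k for an eigenbasis (e_k, l_k) of T; the
   value does not depend on the eigenbasis. *)
Definition spectral_calculus (R : realType) (H : realHilbertType R)
    (f : R -> R) (T : H -> H) : H -> H :=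
  let p := get [set p | eigenbasis T p] in
  fun x => limn (series (fun k => (f (p.2 k) * hdot (p.1 k) x) *: p.1 k)).

Definition op_log (R : realType) (H : realHilbertType R) (T : H -> H) : H -> H :=
  spectral_calculus (@ln R) T.

Definition op_exp (R : realType) (H : realHilbertType R) (T : H -> H) : H -> H :=
  fun x => limn (series (fun k => (k`!%:R)^-1 *: iter k T x)).

Definition op_pow (R : realType) (H : realHilbertType R)
    (T : H -> H) (s : R) : H -> H :=
  op_exp (fun x => s *: op_log T x).

(* (B + m I)^(-1/2) (A + g I) (B + m I)^(-1/2), i.e. Lambda + (g/m) I *)
Definition relative_op (R : realType) (H : realHilbertType R)
    (A : H -> H) (g : R) (B : H -> H) (m : R) : H -> H :=
  let Q := op_pow (plus_scalar B m) (- 2^-1) in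
  fun x => Q (plus_scalar A g (Q x)).

Definition ab_divergence (R : realType) (H : realHilbertType R)
    (alpha beta r : R) (A : H -> H) (g : R) (B : H -> H) (m : R) : R :=
  let L := relative_op A g B m in
  let delta := alpha * g `^ r / (alpha * g `^ r + beta * m `^ r) in
  (alpha * beta)^-1 *
  ln ((g / m) `^ (r * (delta - alpha / (alpha + beta))) *
      detX (fun x => (alpha + beta)^-1 *:
        (alpha *: op_pow L (r * (1 - delta)) x +
         beta *: op_pow L (- (r * delta)) x))).

(* D_(2 alpha)^(alpha, alpha), alpha >= 0 *)
Definition sym_divergence (R : realType) (H : realHilbertType R)
    (alpha : R) (A : H -> H) (g : R) (B : H -> H) (m : R) : R :=
  if alpha == 0 then lim (ab_divergence a a (2 * a) A g B m @[a --> 0^'+])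
  else ab_divergence alpha alpha (2 * alpha) A g B m.

Definition d_aiHS (R : realType) (H : realHilbertType R)
    (A : H -> H) (g : R) (B : H -> H) (m : R) : R :=
  ehs_norm (op_log (relative_op A g B m)).

Definition stein_divergence (R : realType) (H : realHilbertType R)
    (A : H -> H) (g : R) (B : H -> H) (m : R) : R :=
  let L := relative_op A g B m in
  let delta := g / (g + m) in
  ln ((g / m) `^ (delta - 2^-1) *
      detX (fun x => 2^-1 *:
        (op_pow L (1 - delta) x + op_pow L (- delta) x))).

(* Main.v *)
Require Import Defs.
From HB Require Import structures.
From mathcomp Require Import all_boot all_order all_algebra.
From mathcomp Require Import all_classical all_reals all_analysis.
From mathcomp Require Import ring lra.
Import Order.TTheory GRing.Theory Num.Theory.
Import numFieldNormedType.Exports.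
Local Open Scope classical_set_scope.
Local Open Scope ring_scope.

(* Let L = (B + m I)^(-1/2) (A + g I) (B + m I)^(-1/2), with eigenvalues l_k and
   scalar part t = g / m, and put u_k = ln l_k, s = ln t. Writing phi = ln cosh
   and D(x, y) = phi x - phi y - phi'(y) (x - y) for its Bregman divergence, the
   weight delta is exactly the one for which the eigenvalues of the operator
   inside the determinant are c exp (D(a u_k, a s)), where
   c t^(2 a (delta - 1/2)) = cosh (a s). Hence
     D_{2a}^{(a,a)} = a^-2 (phi (a s) + sum_k D(a u_k, a s)).
   All terms are nonnegative and vanish only for s = u_k = 0; the formula is
   invariant under (s, u) -> (-s, -u), which is the effect of exchanging the two
   arguments; and since phi'' = 1 - tanh^2 lies between 1 - x^2 and 1, the right
   hand side tends to (s^2 + sum_k (u_k - s)^2) / 2 as a -> 0. *)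

Set Implicit Arguments.
Unset Strict Implicit.
Unset Printing Implicit Defensive.

(** * Inner products and orthonormal bases *)

(** The definitions rest on choices: [onb], the eigenbasis behind [spectral_calculus] and the scalar
    parts all come from [get]. Each choice has to be shown immaterial before anything can be
    computed in an eigenbasis of the relative operator; for this the operators are rewritten as
    [diag_op], which is determined by its coordinates. The determinant resists most, since its
    sections are taken along [onb], where the operator is not diagonal. The weight works because
    delta = (1 + tanh (a s)) / 2, which subtracts from phi (a u) its tangent slope at a s. The term
    of first order in u_k - s, which is only square summable, disappears, and D(a u_k, a s) <= a^2
    (u_k - s)^2 / 2 is summable: the operator is a positive multiple of the identity plus a
    nonnegative trace-class one. The bounds on phi'' are uniform in k because the spectrum is
    bounded, so the limit a -> 0 is a squeeze between whole sums. *)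

Section HilbertAlgebra.
Context {R : realType} {H : realHilbertType R}.
Implicit Types (x y z : H) (a b : R).

Lemma hdotDr x y z : hdot x (y + z) = hdot x y + hdot x z.
Proof. by rewrite -[y]scale1r hdot_linearr mul1r scale1r. Qed.

Lemma hdot0r x : hdot x 0 = 0.
Proof. by apply: (addrI (hdot x 0)); rewrite -hdotDr !addr0. Qed.

Lemma hdotZr x a y : hdot x (a *: y) = a * hdot x y.
Proof. by rewrite -[a *: y]addr0 hdot_linearr hdot0r addr0. Qed.

Lemma hdotNr x y : hdot x (- y) = - hdot x y.
Proof. by rewrite -scaleN1r hdotZr mulN1r. Qed.

Lemma hdotBr x y z : hdot x (y - z) = hdot x y - hdot x z.
Proof. by rewrite hdotDr hdotNr. Qed.

Lemma hdotDl x y z : hdot (x + y) z = hdot x z + hdot y z.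
Proof. by rewrite !(hdotC _ z) hdotDr. Qed.

Lemma hdotZl a x y : hdot (a *: x) y = a * hdot x y.
Proof. by rewrite !(hdotC _ y) hdotZr. Qed.

Lemma hdot_sumr (I : Type) (r : seq I) (P : pred I) (F : I -> H) x :
  hdot x (\sum_(i <- r | P i) F i) = \sum_(i <- r | P i) hdot x (F i).
Proof.
elim/big_rec2: _ => [|i y1 y2 _ <-]; first by rewrite hdot0r.
by rewrite hdotDr.
Qed.

Lemma hdot_suml (I : Type) (r : seq I) (P : pred I) (F : I -> H) x :
  hdot (\sum_(i <- r | P i) F i) x = \sum_(i <- r | P i) hdot (F i) x.
Proof. by rewrite hdotC hdot_sumr; apply: eq_bigr => i _; rewrite hdotC. Qed.

Lemma hdot_ge0 x : 0 <= hdot x x.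
Proof. by rewrite hdot_norm sqr_ge0. Qed.

Lemma hdot_eq0 x : hdot x x = 0 -> x = 0.
Proof. by rewrite hdot_norm => /eqP; rewrite sqrf_eq0 normr_eq0 => /eqP. Qed.

Lemma sqr_normD x y : `|x + y| ^+ 2 = `|x| ^+ 2 + 2 * hdot x y + `|y| ^+ 2.
Proof. by rewrite -!hdot_norm !hdotDl !hdotDr (hdotC y x); ring. Qed.

Lemma sqr_normB x y : `|x - y| ^+ 2 = `|x| ^+ 2 - 2 * hdot x y + `|y| ^+ 2.
Proof. by rewrite sqr_normD normrN hdotNr mulrN. Qed.

Lemma sqr_normD_le x y : `|x + y| ^+ 2 <= 2 * (`|x| ^+ 2 + `|y| ^+ 2).
Proof.
have := sqr_ge0 `|x - y|; rewrite sqr_normB sqr_normD; lra.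
Qed.

Lemma cauchy_schwarz x y : `|hdot x y| <= `|x| * `|y|.
Proof.
have [->|y0] := eqVneq y 0; first by rewrite hdot0r !normr0 mulr0.
have y2 : 0 < `|y| ^+ 2 by rewrite exprn_gt0 // normr_gt0.
rewrite -(@ler_pXn2r _ 2) ?nnegrE ?mulr_ge0 // real_normK ?num_real // exprMn.
have := hdot_ge0 (x - (hdot x y / `|y| ^+ 2) *: y).
rewrite hdot_norm sqr_normB hdotZr normrZ exprMn real_normK ?num_real //.
set d := hdot x y => h.
have : 0 <= `|x| ^+ 2 - d ^+ 2 / `|y| ^+ 2.
  apply: (le_trans h); rewrite le_eqVlt; apply/orP; left; apply/eqP.
  by field; rewrite normr_eq0.
by rewrite subr_ge0 ler_pdivrMr.
Qed.

(** The discriminant argument for the form <x, B y>, which may be degenerate: if <y, B y> = 0, a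
    nonnegative affine function of c must have slope zero. *)
Lemma cauchy_schwarz_pos (B : H -> H) : linear B -> self_adjoint B ->
  (forall x, 0 <= hdot x (B x)) ->
  forall x y, hdot x (B y) ^+ 2 <= hdot x (B x) * hdot y (B y).
Proof.
move=> Blin Bsa Bpos x y.
have h c : 0 <= hdot x (B x) + c * 2 * hdot x (B y) + c ^+ 2 * hdot y (B y).
  have := Bpos (c *: y + x); rewrite Blin !hdotDl !hdotDr !hdotZl !hdotZr.
  by rewrite (_ : hdot y (B x) = hdot x (B y)) -?Bsa 1?hdotC//; nra.
have := Bpos y; rewrite le_eqVlt => /orP[/eqP y0|y0].
  rewrite -y0 mulr0; move: h; rewrite -y0; move: (hdot x (B y)) (hdot x (B x)) => q p h.
  have [->|q0] := eqVneq q 0; first by rewrite expr0n.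
  (* At this c the affine function takes the value -1. *)
  have := h (- (p + 1) / (2 * q)).
  rewrite (_ : _ * 2 * q = - (p + 1)); last by field.
  lra.
have := h (- hdot x (B y) / hdot y (B y)).
move: y0; move: (hdot x (B y)) (hdot x (B x)) (hdot y (B y)) => q p s s0.
rewrite (_ : _ + _ = p - q ^+ 2 / s); last by field; rewrite gt_eqF.
by rewrite subr_ge0 ler_pdivrMr.
Qed.

Lemma hdot_continuous y : continuous (hdot y : H -> R).
Proof.
move=> x; apply/cvgrPdist_lt => e e0.
have e1 : 0 < e / (`|y| + 1) by rewrite divr_gt0 // ltr_wpDl.
near=> z; rewrite -hdotBr; apply: le_lt_trans (cauchy_schwarz _ _) _.
have : `|x - z| < e / (`|y| + 1).
  by near: z; apply: (@cvgr_dist_lt _ _ _ _ _ id); [exact: cvg_id|exact: e1].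
have y1 : 0 < `|y| + 1 by rewrite ltr_wpDl.
rewrite ltr_pdivlMr // => h; apply: le_lt_trans h.
by rewrite mulrC ler_wpM2l // lerDl.
Unshelve. all: by end_near. Qed.

Lemma cvg_hdotr (T : Type) (F : set_system T) {FF : Filter F} (f : T -> H) x y :
  f @ F --> x -> (fun t => hdot y (f t)) @ F --> hdot y x.
Proof. by move=> fx; apply: (cvg_comp _ _ fx); exact: hdot_continuous. Qed.

End HilbertAlgebra.

(** * Series with nonnegative terms *)

Section NonnegativeSeries.
Context {R : realType}.
Implicit Types (u v : R^nat).

Lemma nondecreasing_nneg_series u : (forall n, 0 <= u n) ->
  {homo series u : m n / (m <= n)%N >-> m <= n}.
Proof.
by move=> u0 m n mn; rewrite -subr_ge0 sub_series_geq // sumr_ge0.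
Qed.

Lemma nneg_series_bounded_cvg u M : (forall n, 0 <= u n) ->
  (forall n, series u n <= M) -> cvgn (series u).
Proof.
move=> u0 uM; apply: nondecreasing_is_cvgn; first exact: nondecreasing_nneg_series.
by exists M => _ [n _ <-].
Qed.

Lemma nneg_series_le_lim u n : (forall n, 0 <= u n) -> cvgn (series u) ->
  series u n <= limn (series u).
Proof.
by move=> u0 cu; apply: nondecreasing_cvgn_le => //; exact: nondecreasing_nneg_series.
Qed.

Lemma nneg_series_lim_le u M : cvgn (series u) ->
  (forall n, series u n <= M) -> limn (series u) <= M.
Proof. by move=> cu uM; apply: limr_le => //; apply: nearW. Qed.

Lemma nneg_series_lim_ge0 u : (forall n, 0 <= u n) -> cvgn (series u) ->
  0 <= limn (series u).
Proof. by move=> u0 cu; apply: le_trans (nneg_series_le_lim 0 u0 cu); rewrite seriesEnat /= big_geq. Qed.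

Lemma nneg_series_term_le_lim u k : (forall n, 0 <= u n) -> cvgn (series u) ->
  u k <= limn (series u).
Proof.
move=> u0 cu; apply: le_trans (nneg_series_le_lim k.+1 u0 cu).
by rewrite seriesSr lerDr seriesEnat /= sumr_ge0.
Qed.

Lemma nneg_series_lim_eq0 u : (forall n, 0 <= u n) -> cvgn (series u) ->
  limn (series u) = 0 -> forall k, u k = 0.
Proof.
move=> u0 cu l0 k; apply/eqP; rewrite eq_le u0 andbT -l0.
exact: nneg_series_term_le_lim.
Qed.

End NonnegativeSeries.

(** * Orthonormal sequences: Bessel, Riesz-Fischer, Parseval *)

Section Orthonormal.
Context {R : realType} {H : realHilbertType R}.
Implicit Types (x y z : H) (e : nat -> H) (c : nat -> R).

Definition orthonormal e := forall i j, hdot (e i) (e j) = (i == j)%:R :> R.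

Lemma orthonormal_norm e k : orthonormal e -> `|e k| = 1.
Proof.
move=> oe; have := hdot_norm (e k); rewrite oe eqxx => /esym/eqP.
by rewrite sqrf_eq1 => /orP[/eqP//|/eqP h]; have := normr_ge0 (e k); rewrite h; lra.
Qed.

Lemma hdot_series y (u : nat -> H) n :
  hdot y (series u n) = series (fun k => hdot y (u k)) n.
Proof. by rewrite !seriesEnat /= hdot_sumr. Qed.

Lemma hdot_series_cvg y (u : nat -> H) x : series u @ \oo --> x ->
  series (fun k => hdot y (u k)) @ \oo --> hdot y x.
Proof.
move=> /(cvg_hdotr (y := y)); apply: cvg_trans; apply: near_eq_cvg.
by apply: nearW => n; rewrite hdot_series.
Qed.

Lemma orthonormal_comb_hdot e c m n k : orthonormal e ->
  hdot (e k) (\sum_(m <= i < n) c i *: e i) = if (m <= k < n)%N then c k else 0.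
Proof.
move=> oe; rewrite hdot_sumr.
under eq_bigr do rewrite hdotZr oe.
case: ifPn => kmn.
  rewrite (bigD1_seq k) ?mem_index_iota ?iota_uniq //= eqxx mulr1 big1 ?addr0 //.
  by move=> i ik; rewrite eq_sym (negbTE ik) mulr0.
rewrite big_seq_cond big1 // => i; rewrite andbT mem_index_iota => imn.
by case: eqP kmn => [->|_ _]; [rewrite imn|rewrite mulr0].
Qed.

Lemma orthonormal_comb_norm e c m n : orthonormal e ->
  `|\sum_(m <= i < n) c i *: e i| ^+ 2 = \sum_(m <= i < n) c i ^+ 2.
Proof.
move=> oe; rewrite -hdot_norm hdot_suml big_seq [RHS]big_seq.
apply: eq_bigr => k; rewrite mem_index_iota => kmn.
by rewrite hdotZl orthonormal_comb_hdot // kmn expr2.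
Qed.

(** By Pythagoras the squared norm of a block of the vector series is the same block of the scalar
    series, so the Cauchy criterion passes from one to the other. *)
Lemma riesz_fischer e c : orthonormal e -> cvgn (series (fun k => c k ^+ 2)) ->
  cvgn (series (fun k => c k *: e k)).
Proof.
move=> oe /cauchy_cvgP/cauchy_seriesP cc; apply/cauchy_cvgP/cauchy_seriesP => eps e0.
have e2 : 0 < eps ^+ 2 by rewrite exprn_gt0.
have := cc _ e2; apply: filterS => mn.
rewrite -(orthonormal_comb_norm (e := e)) // ger0_norm ?sqr_ge0 //.
by rewrite ltr_pXn2r ?nnegrE // ltW.
Qed.

Lemma bessel e x n : orthonormal e ->
  series (fun k => hdot (e k) x ^+ 2) n <= `|x| ^+ 2.
Proof.
move=> oe; have := sqr_ge0 `|x - series (fun k => hdot (e k) x *: e k) n|.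
rewrite sqr_normB {2}seriesEnat /= orthonormal_comb_norm // hdot_series.
rewrite (_ : series _ n = series (fun k => hdot (e k) x ^+ 2) n); first by rewrite !seriesEnat /=; lra.
by rewrite !seriesEnat /=; apply: eq_bigr => k _; rewrite hdotZr (hdotC x) expr2.
Qed.

Lemma bessel_cvg e x : orthonormal e -> cvgn (series (fun k => hdot (e k) x ^+ 2)).
Proof.
move=> oe; apply: (@nneg_series_bounded_cvg _ _ (`|x| ^+ 2)) => n; first exact: sqr_ge0.
exact: bessel.
Qed.

Lemma orthonormal_coord e c x k : orthonormal e ->
  series (fun k => c k *: e k) @ \oo --> x -> hdot (e k) x = c k.
Proof.
move=> oe cx; have /cvg_lim <- // := hdot_series_cvg (y := e k) cx.
apply: lim_near_cst => //; exists k.+1 => // n /= kn.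
by rewrite -hdot_series seriesEnat /= orthonormal_comb_hdot // kn.
Qed.

(** The Fourier series of x converges by Riesz-Fischer, and its sum has the coordinates of x; the
    difference is orthogonal to every e_k. *)
Lemma complete_orthonormal_basis e : orthonormal e ->
  (forall x, (forall k, hdot (e k) x = 0) -> x = 0) -> orthonormal_basis e.
Proof.
move=> oe ce; split=> // x.
have h := riesz_fischer oe (bessel_cvg (x := x) oe).
suff xl : limn (series (fun k => hdot (e k) x *: e k)) = x by rewrite -[X in _ --> X]xl.
apply/eqP; rewrite -subr_eq0; apply/eqP/ce => k.
by rewrite hdotBr [X in X - _](orthonormal_coord (c := fun k => hdot (e k) x)) // subrr.
Qed.

Section Basis.
Variable e : nat -> H.
Hypothesis be : orthonormal_basis e.

Lemma basis_orthonormal : orthonormal e. Proof. by case: be. Qed.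

Lemma parseval_hdot x y :
  series (fun k => hdot (e k) x * hdot (e k) y) @ \oo --> hdot x y.
Proof.
have [_ /(_ y)/(hdot_series_cvg (y := x))] := be.
by under eq_fun do rewrite hdotZr (hdotC x) mulrC.
Qed.

Lemma parseval x : series (fun k => hdot (e k) x ^+ 2) @ \oo --> `|x| ^+ 2.
Proof.
by rewrite -hdot_norm; under eq_fun do rewrite expr2; exact: parseval_hdot.
Qed.

Lemma basis_ext x y : (forall k, hdot (e k) x = hdot (e k) y) -> x = y.
Proof.
move=> exy; have [_ h] := be; have := h x; under eq_fun do rewrite exy.
by move=> /cvg_lim <- //; apply: cvg_lim (h y).
Qed.

End Basis.
End Orthonormal.

Arguments parseval {R H e} be x.
Arguments parseval_hdot {R H e} be x y.

(** * Spectral theorem for self-adjoint Hilbert-Schmidt operators *)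

Section Eigenbasis.
Context {R : realType} {H : realHilbertType R}.
Implicit Types (x y z v w : H) (A : H -> H) (S : set H).

Lemma linear_add A : linear A -> {morph A : x y / x + y}.
Proof. by move=> lA x y; have := lA 1 x y; rewrite !scale1r. Qed.

Lemma linear_0 A : linear A -> A 0 = 0.
Proof. by move=> lA; apply: (addrI (A 0)); rewrite -linear_add // !addr0. Qed.

Lemma linear_scale A a x : linear A -> A (a *: x) = a *: A x.
Proof. by move=> lA; rewrite -[a *: x]addr0 lA linear_0 // addr0. Qed.

Lemma linear_sub A : linear A -> {morph A : x y / x - y}.
Proof. by move=> lA x y; rewrite linear_add // -scaleN1r linear_scale // scaleN1r. Qed.

(** A set rather than a sequence, because Zorn's lemma yields one of unknown cardinality; it is
    shown countable and infinite afterwards. *)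
Definition orthonormal_set S :=
  forall v w, S v -> S w -> hdot v w = (v == w)%:R :> R.

Definition orthonormal_eigenvectors A S :=
  orthonormal_set S /\ forall v, S v -> exists a : R, A v = a *: v.

Lemma orthonormal_set_norm S v : orthonormal_set S -> S v -> `|v| = 1.
Proof.
move=> oS Sv; have := hdot_norm v; rewrite oS // eqxx => /esym/eqP.
by rewrite sqrf_eq1 => /orP[/eqP//|/eqP h]; have := normr_ge0 v; rewrite h; lra.
Qed.

(** Distinct elements lie at distance sqrt 2, so sending each to a point of the dense set within 1/2
    of it is injective. *)
Lemma separable_orthonormal_countable S : separable_space H ->
  orthonormal_set S -> countable S.
Proof.
move=> [D /countable_injP[g ginj] dD] oS; apply/countable_injP.
have near_D v : exists d, D d /\ `|v - d| < 2^-1.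
  have [||d [/= bd Dd]] := dD (ball v (2^-1 : R)).
  - by exists v; apply: ballxx; rewrite invr_gt0.
  - exact: ball_open.
  by exists d; split=> //; move: bd; rewrite -ball_normE.
pose f v := sval (cid (near_D v)).
have fD v : D (f v) by rewrite /f; case: cid => d [].
have fd v : `|v - f v| < 2^-1 by rewrite /f; case: cid => d [].
exists (g \o f) => v w; rewrite !inE => Sv Sw /= /ginj.
rewrite !inE => /(_ (fD v) (fD w)) fvw; apply/eqP/negPn/negP => vw.
have h : `|v - w| < 1.
  rewrite (_ : v - w = (v - f v) - (w - f w)); last by rewrite fvw opprB addrA subrK.
  apply: le_lt_trans (ler_normB _ _) _.
  by have := fd v; have := fd w; lra.
have : `|v - w| ^+ 2 < 1 by rewrite expr_lt1.
rewrite sqr_normB oS // (negbTE vw) (orthonormal_set_norm oS Sv).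
by rewrite (orthonormal_set_norm oS Sw) mulr0 subr0 expr1n; lra.
Qed.

(** If S were finite, every x minus its expansion along S would be orthogonal to S, hence zero, and
    S would span. [undup] makes the enumeration of S injective. *)
Lemma total_orthonormal_infinite S : infinite_dimensional H ->
  orthonormal_set S -> (forall x, (forall v, S v -> hdot v x = 0) -> x = 0) ->
  infinite_set S.
Proof.
move=> hinf oS tS /finite_seqP[s Ss].
have [x /(_ (fun i => hdot (undup s)`_i x))] := hinf _ (fun i : 'I_(size (undup s)) => (undup s)`_i).
apply; apply/eqP; rewrite -subr_eq0; apply/eqP/tS => v Sv.
have vs : v \in undup s by move: Sv; rewrite Ss /= mem_undup.
have iv : (index v (undup s) < size (undup s))%N by rewrite index_mem.
rewrite hdotBr hdot_sumr (bigD1 (Ordinal iv)) //= big1 ?addr0.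
  by rewrite nth_index // hdotZr (oS v v) // eqxx mulr1 subrr.
move=> i; rewrite -val_eqE /= => iv'.
have Si : S (undup s)`_i by rewrite Ss /=; rewrite -mem_undup; apply: mem_nth.
rewrite hdotZr (oS v) //.
rewrite -[X in X == _](nth_index 0 vs) nth_uniq ?undup_uniq //.
by rewrite eq_sym (negbTE iv') mulr0.
Qed.

Lemma normalize_norm v : v != 0 -> `| `|v|^-1 *: v | = 1.
Proof.
by move=> v0; rewrite normrZ normfV normr_id mulVf // normr_eq0.
Qed.

(** Zorn's lemma, with the spectral input isolated as a hypothesis: an orthonormal set of
    eigenvectors that is not total leaves room for one more. A maximal set is then total, and can be
    indexed by [nat]. This form serves both the zero operator, for the existence of a basis, and
    Hilbert-Schmidt operators. *)
Lemma eigenbasis_exists A : separable_space H -> infinite_dimensional H ->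
  (forall S x, orthonormal_eigenvectors A S -> x != 0 ->
     (forall v, S v -> hdot v x = 0) ->
     exists v, [/\ v != 0, exists a : R, A v = a *: v & forall w, S w -> hdot w v = 0]) ->
  linear A ->
  exists p, eigenbasis A p.
Proof.
move=> hsep hinf ext Alin.
have [F FP Ftot|S [[oS eS] maxS]] := @Zorn_bigcup H (orthonormal_eigenvectors A).
  split=> [v w [X FX Xv] [Y FY Yw]|v [X FX Xv]]; last exact: (FP _ FX).2.
  by have [XY|YX] := Ftot _ _ FX FY; [apply: (FP _ FY).1 => //; exact: XY|apply: (FP _ FX).1 => //; exact: YX].
have tS x : (forall v, S v -> hdot v x = 0) -> x = 0.
  move=> Sx; apply/eqP/negPn/negP => x0.
  have [//|v [v0 [a Av] Sv]] := ext S x _ x0 Sx.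
  pose v' := `|v|^-1 *: v.
  have v1 : `|v'| = 1 by exact: normalize_norm.
  have Sv' w : S w -> hdot w v' = 0 by move=> Sw; rewrite hdotZr Sv // mulr0.
  have nSv' : ~ S v'.
    by move=> /Sv'/eqP; rewrite hdot_norm v1 expr1n oner_eq0.
  apply: (maxS (S `|` [set v'])).
    by split=> [w|h]; [left|apply: nSv'; apply: h; right].
  split=> [u w [Su|->] [Sw|->]|u [/eS//|->]].
  - exact: oS.
  - by rewrite Sv' //; case: eqP => // uv; move: nSv'; rewrite -uv.
  - by rewrite hdotC Sv' //; case: eqP => // uv; move: nSv'; rewrite uv.
  - by rewrite hdot_norm v1 expr1n eqxx.
  - by exists a; rewrite linear_scale // Av !scalerA mulrC.
have cS := separable_orthonormal_countable hsep oS.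
have /card_esym/card_set_bijP[f [fS finj fsurj]] := eq_card_nat cS (total_orthonormal_infinite hinf oS tS).
have fS' k : S (f k) by apply: fS.
have /choice[l lf] k : exists a : R, A (f k) = a *: f k by exact: eS.
exists (f, l); split=> //=; apply: complete_orthonormal_basis.
  move=> i j; rewrite oS //; congr (_%:R); congr nat_of_bool.
  by apply/eqP/eqP => [/finj->//|->//]; rewrite !inE.
move=> x fx; apply: tS => v /fsurj[k _ <-]; exact: fx.
Qed.

(** Every vector is an eigenvector of the zero operator, so the extension hypothesis is immediate
    and the [get] in [onb] picks a genuine basis. *)
Lemma onb_basis : separable_space H -> infinite_dimensional H ->
  orthonormal_basis (onb H).
Proof.
move=> hsep hinf; apply: (@getPex _ [set e : nat -> H | orthonormal_basis e]).
have [|x a y|[e l] [be _]] := @eigenbasis_exists (fun=> 0) hsep hinf; last by exists e.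
  move=> S x _ x0 Sx; exists x; split=> //; exists 0; rewrite scale0r//.
by rewrite scaler0 addr0.
Qed.

End Eigenbasis.

(** * Bounded operators, Hilbert-Schmidt sums and compactness *)

Section BoundedOperators.
Context {R : realType} {H : realHilbertType R}.
Implicit Types (x y z v w : H) (A B : H -> H).

Lemma cvg_finite_sum (V : normedModType R) (T J : Type) (F : set_system T)
    (FF : Filter F) (r : seq J) (f : J -> T -> V) (l : J -> V) :
  (forall j, f j @ F --> l j) ->
  (fun t => \sum_(j <- r) f j t) @ F --> \sum_(j <- r) l j.
Proof.
move=> fl; elim: r => [|j r IH].
  by rewrite big_nil; under eq_fun do rewrite big_nil; exact: cvg_cst.
rewrite big_cons; under eq_fun do rewrite big_cons; exact: cvgD.
Qed.

Lemma bounded_operatorP A : bounded_operator A <->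
  linear A /\ exists2 C : R, 0 < C & forall x, `|A x| <= C * `|x|.
Proof.
split=> [[lA cA]|[lA [C C0 hC]]]; split => //.
  pose f : {linear H -> H} := HB.pack A (GRing.isLinear.Build _ _ _ _ A lA).
  have /linear_boundedP[M [Mr hM]] : bounded_near f (nbhs 0).
    by apply: continuous_linear_bounded; exact: cA.
  exists (`|M| + 1) => [|x]; first by rewrite ltr_wpDl.
  by apply: (hM (`|M| + 1)); rewrite (le_lt_trans (ler_norm M)) // ltrDl.
move=> x; apply/cvgrPdist_lt => e e0; near=> z.
rewrite -linear_sub //; apply: le_lt_trans (hC _) _.
rewrite mulrC -ltr_pdivlMr //.
near: z; apply: (@cvgr_dist_lt _ _ _ _ _ id); [exact: cvg_id|exact: divr_gt0].
Unshelve. all: by end_near. Qed.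

(** Both sums are the double sum of <f_j, A e_k>^2, taken in either order. Only finite sums are
    exchanged: Parseval over j for finitely many k, then Bessel over k for each j. *)
Lemma adjoint_square_sum_le (e f : nat -> H) A B :
  orthonormal_basis e -> orthonormal_basis f ->
  (forall x y, hdot (A x) y = hdot x (B y)) ->
  cvgn (series (fun k => `|B (f k)| ^+ 2)) ->
  cvgn (series (fun k => `|A (e k)| ^+ 2)) /\
  limn (series (fun k => `|A (e k)| ^+ 2)) <= limn (series (fun k => `|B (f k)| ^+ 2)).
Proof.
move=> be bf AB cB; set M := limn (series (fun k => `|B (f k)| ^+ 2)).
have h n : series (fun k => `|A (e k)| ^+ 2) n <= M.
  have hc : (fun m => \sum_(0 <= k < n) series (fun j => hdot (f j) (A (e k)) ^+ 2) m) @ \oo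
     --> \sum_(0 <= k < n) `|A (e k)| ^+ 2.
    by apply: cvg_finite_sum => k; exact: parseval.
  rewrite seriesEnat /= -(cvg_lim _ hc) //; apply: limr_le; first by apply/cvg_ex; eexists; exact: hc.
  apply: nearW => m; under eq_bigr do rewrite seriesEnat /=.
  rewrite exchange_big /=.
  apply: le_trans (nneg_series_le_lim m _ cB) => [|k]; last exact: sqr_ge0.
  rewrite /series /=; apply: ler_sum => j _.
  apply: le_trans (bessel (B (f j)) n (basis_orthonormal be)).
  rewrite /series /=; apply: ler_sum => k _.
  by rewrite hdotC AB.
have c : cvgn (series (fun k => `|A (e k)| ^+ 2)).
  by apply: (nneg_series_bounded_cvg _ h) => k; exact: sqr_ge0.
by split=> //; apply: nneg_series_lim_le.
Qed.

Lemma square_sum_basis_indep (e f : nat -> H) A :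
  orthonormal_basis e -> orthonormal_basis f -> self_adjoint A ->
  cvgn (series (fun k => `|A (e k)| ^+ 2)) ->
  cvgn (series (fun k => `|A (f k)| ^+ 2)) /\
  limn (series (fun k => `|A (f k)| ^+ 2)) = limn (series (fun k => `|A (e k)| ^+ 2)).
Proof.
move=> be bf sA ce.
have [cf fe] := adjoint_square_sum_le bf be sA ce.
have [_ ef] := adjoint_square_sum_le be bf sA cf.
by split=> //; apply/eqP; rewrite eq_le fe.
Qed.

(** A cluster point is adherent to every set of the ultrafilter, so the complement of a
    neighbourhood of it cannot belong to the ultrafilter. *)
Lemma ultra_cvg_compact (T : Type) (X : topologicalType) (G : set_system T)
    (h : T -> X) (K : set X) : UltraFilter G -> compact K -> G (h @^-1` K) ->
  exists p : X, h @ G --> p.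
Proof.
move=> uG cK GK; have [p [_ cp]] := cK (h @ G) _ GK.
exists p => U Up; have [//|GU] := in_ultra_setVsetC (h @^-1` U) uG.
by have [x []] := cp (~` U) U GU Up.
Qed.

(* Compactness of a Hilbert-Schmidt operator: finitely many coordinates of [A x]
   converge along [G], and the others are uniformly small. *)
Lemma ultra_hs_cvg (e : nat -> H) A (G : set_system H) : orthonormal_basis e ->
  bounded_operator A -> self_adjoint A -> cvgn (series (fun k => `|A (e k)| ^+ 2)) ->
  UltraFilter G -> G [set x | `|x| = 1] -> exists y : H, A @ G --> y.
Proof.
move=> be /bounded_operatorP[lA [C C0 AC]] sA cA uG G1.
have /choice[c hc] k : exists c : R, (fun x => hdot (e k) (A x)) @ G --> c.
  apply: (ultra_cvg_compact (K := `[- C, C])) => //; first exact: segment_compact.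
  apply: filterS G1 => x /= x1; rewrite in_itv /= -ler_norml.
  apply: le_trans (cauchy_schwarz _ _) _; rewrite (orthonormal_norm _ (basis_orthonormal be)) mul1r.
  by have := AC x; rewrite x1 mulr1.
suff /cauchy_cvgP : cauchy (A @ G) by move=> /cvg_ex.
apply: cauchy_exP => eps e0.
have d0 : 0 < (eps / 2) ^+ 2 by rewrite exprn_gt0 // divr_gt0.
have /cvgrPdist_lt/(_ _ d0) [N _ /(_ N (leqnn N)) /=] := cA.
set S := limn _ => hN.
(* [cauchy_exP] asks only for some ball of radius eps in the filter; its centre is the truncation of
   the limit to N coordinates, where N makes the tail of the sum of |A e_k|^2 smaller than (eps /
   2)^2. *)
exists (\sum_(0 <= k < N) c k *: e k).
have hs : (fun x => \sum_(0 <= k < N) hdot (e k) (A x) *: e k) @ G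
    --> \sum_(0 <= k < N) c k *: e k.
  by apply: cvg_finite_sum => k; apply: cvgZr_tmp; exact: hc.
have e2 : 0 < eps / 2 by rewrite divr_gt0.
have /cvgrPdist_lt/(_ _ e2) := hs.
apply: filterS2 G1 => x /= x1 hx; rewrite -ball_normE /=.
set y := \sum_(0 <= k < N) c k *: e k in hx *.
set s := \sum_(0 <= k < N) hdot (e k) (A x) *: e k in hx.
rewrite (_ : y - A x = (y - s) - (A x - s)); last by rewrite opprB addrA subrK.
apply: le_lt_trans (ler_normB _ _) _.
suff : `|A x - s| < eps / 2 by move: hx; lra.
rewrite -(@ltr_pXn2r _ 2) ?nnegrE // ?ltW // -?/(_ ^+ 2); apply: le_lt_trans hN.
rewrite ger0_norm; last by rewrite subr_ge0; apply: nneg_series_le_lim => // k; exact: sqr_ge0.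
have -> : `|A x - s| ^+ 2 = `|A x| ^+ 2 - series (fun k => hdot (e k) (A x) ^+ 2) N.
  rewrite sqr_normB orthonormal_comb_norm; last exact: basis_orthonormal.
  rewrite hdot_sumr (_ : \sum_(_ <= _ < _) _ = series (fun k => hdot (e k) (A x) ^+ 2) N).
    by rewrite seriesEnat /=; lra.
  by rewrite seriesEnat; apply: eq_bigr => k _; rewrite hdotZr (hdotC (A x)) expr2.
set u := series (fun k => hdot (e k) (A x) ^+ 2).
have hu : (fun m => u m - u N) @ \oo --> `|A x| ^+ 2 - u N.
  by apply: cvgB; [exact: parseval|exact: cvg_cst].
rewrite -(cvg_lim _ hu) //; apply: limr_le; first by apply/cvg_ex; eexists; exact: hu.
exists N => // m /= Nm; rewrite sub_series_geq //.
(* Termwise, |<e_k, A x>| = |<A e_k, x>| is at most |A e_k|, since |x| = 1. *)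
apply: (@le_trans _ _ (series (fun k => `|A (e k)| ^+ 2) m - series (fun k => `|A (e k)| ^+ 2) N)).
  rewrite sub_series_geq //; apply: ler_sum => k _.
  rewrite -sA -[leLHS]real_normK ?num_real // ler_pXn2r ?nnegrE //.
  by apply: le_trans (cauchy_schwarz _ _) _; rewrite x1 mulr1.
by rewrite lerB //; apply: nneg_series_le_lim => // k; exact: sqr_ge0.
Qed.

End BoundedOperators.

(** * Eigenvectors of self-adjoint Hilbert-Schmidt operators *)

Section Spectral.
Context {R : realType} {H : realHilbertType R}.
Implicit Types (x y z v w : H) (A B : H -> H).

Lemma cvg_eventually_cst (T : Type) (V : normedModType R) (F : set_system T)
    (FF : ProperFilter F) (f : T -> V) l c :
  f @ F --> l -> F [set t | f t = c] -> l = c.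
Proof.
move=> fl fc; have fc' : f @ F --> c by apply: cvg_near_cst; exact: fc.
by rewrite -(cvg_lim _ fl) // -(cvg_lim _ fc').
Qed.

(* If [M] is the supremum of [|A x|^2] over the unit sphere of the orthogonal
   complement of [S], a maximizing sequence satisfies [A (A x) - M x -> 0]; a limit
   [z] of it along an ultrafilter satisfies [A (A z) = M z], so that either [z] or
   [A z + sqrt M z] is an eigenvector of [A]. *)
Lemma hs_eigenvector (e : nat -> H) A (S : set H) x0 : orthonormal_basis e ->
  bounded_operator A -> self_adjoint A -> cvgn (series (fun k => `|A (e k)| ^+ 2)) ->
  (forall w, S w -> exists a : R, A w = a *: w) ->
  x0 != 0 -> (forall w, S w -> hdot w x0 = 0) ->
  exists v, [/\ v != 0, exists a : R, A v = a *: v & forall w, S w -> hdot w v = 0].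
Proof.
move=> be bA sA hsA eS x00 Sx0.
have [lA [C C0 AC]] := (bounded_operatorP A).1 bA.
have cA : continuous A by case: bA.
pose V := [set x | forall w, S w -> hdot w x = 0].
have AV x : V x -> V (A x).
  by move=> Vx w Sw; have [a Aw] := eS w Sw; rewrite -sA Aw hdotZl Vx // mulr0.
have VZ a x : V x -> V (a *: x) by move=> Vx w Sw; rewrite hdotZr Vx // mulr0.
pose E := [set `|A x| ^+ 2 | x in [set x | V x /\ `|x| = 1]].
have x0n : V (`|x0|^-1 *: x0) /\ `| `|x0|^-1 *: x0| = 1.
  by split; [exact: VZ|exact: normalize_norm].
have E0 : E !=set0 by exists (`|A (`|x0|^-1 *: x0)| ^+ 2), (`|x0|^-1 *: x0).
have EC : has_ubound E.
  exists (C ^+ 2) => _ [x [_ x1] <-]; rewrite ler_pXn2r ?nnegrE ?(ltW C0) //.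
  by have := AC x; rewrite x1 mulr1.
pose M := sup E.
have EM x : V x -> `|A x| ^+ 2 <= M * `|x| ^+ 2.
  move=> Vx; have [->|xn0] := eqVneq x 0; first by rewrite linear_0 // normr0 expr0n mulr0.
  have : E (`|A (`|x|^-1 *: x)| ^+ 2).
    by exists (`|x|^-1 *: x) => //; split; [exact: VZ|exact: normalize_norm].
  move=> /(ub_le_sup EC); rewrite -/M linear_scale // normrZ normfV normr_id exprMn exprVn.
  by rewrite mulrC ler_pdivrMr // exprn_gt0 // normr_gt0.
have M0 : 0 <= M.
  have := EM _ x0n.1; rewrite x0n.2 expr1n mulr1; apply: le_trans; exact: sqr_ge0.
(* If M = 0, then A vanishes on the orthogonal complement of S and the given vector is already an
   eigenvector. *)
have [Mz|Mn0] := eqVneq M 0.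
  exists x0; split=> //; exists 0; rewrite scale0r; apply: hdot_eq0; rewrite hdot_norm.
  by apply/eqP; rewrite eq_le sqr_ge0 andbT; have := EM _ Sx0; rewrite Mz mul0r.
have Mgt0 : 0 < M by rewrite lt_def Mn0.
have /choice[x hx] n : exists x : H, [/\ V x, `|x| = 1 & M - n.+1%:R^-1 < `|A x| ^+ 2].
  have [|_ [x [Vx x1] <-] h] := @sup_adherent _ E n.+1%:R^-1 _ (conj E0 EC).
    by rewrite invr_gt0.
  by exists x.
(* The ultrafilter takes the place of a convergent subsequence of the maximizing sequence. *)
have [G [uG FG]] := @ultraFilterLemma H (x @ \oo) _.
have pG : ProperFilter G by exact: ultra_proper.
have fG : Filter G by exact: filter_filter.
have GV : G [set y | V y /\ `|y| = 1].
  by apply: FG; exists 0%N => // n _ /=; have [] := hx n.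
have GM : (fun y => `|A y| ^+ 2) @ G --> M.
  suff h : (fun n => `|A (x n)| ^+ 2) @ \oo --> M by move=> U /h; exact: FG.
  apply: (@squeeze_cvgr _ _ _ _ (fun n => M - n.+1%:R^-1) (fun=> M)).
  - apply: nearW => n; have [Vx x1 /ltW ->] := hx n.
    by have := EM _ Vx; rewrite x1 expr1n mulr1.
  - rewrite -[X in _ --> X]subr0; apply: cvgB; [exact: cvg_cst|exact: cvg_harmonic].
  - exact: cvg_cst.
have [|y Ay] := ultra_hs_cvg be bA sA hsA uG; first by apply: filterS GV => z [].
have AAy : (fun z => A (A z)) @ G --> A y.
  by apply: (cvg_comp _ _ Ay); exact: cA.
(* Expanding, and using |A (A z)|^2 <= M |A z|^2 in the complement, bounds |A (A z) - M z|^2 by M (M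
   - |A z|^2); hence the threshold eps^2 / M. *)
have d0 : (fun z => A (A z) - M *: z) @ G --> (0 : H).
  apply/cvgrPdist_lt => eps eps0.
  have eps1 : 0 < eps ^+ 2 / M by rewrite divr_gt0 // exprn_gt0.
  have /cvgrPdist_lt/(_ _ eps1) := GM.
  apply: filterS2 GV => z [Vz z1] /(le_lt_trans (ler_norm _)) hz.
  rewrite sub0r normrN -(@ltr_pXn2r _ 2) ?nnegrE ?(ltW eps0) //.
  rewrite sqr_normB hdotZr sA hdot_norm normrZ exprMn z1 expr1n mulr1.
  rewrite (ger0_norm M0); move: hz; rewrite ltr_pdivlMr //.
  have := EM _ (AV _ Vz); nra.
(* A (A z) tends to A y, so M z does too. Dividing by M > 0, the ultrafilter itself converges in
   norm, and |z| = 1, orthogonality to S and A A z = M z pass to its limit. *)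
have Mz : (fun z => M *: z) @ G --> A y.
  rewrite -[A y]subr0 (_ : (fun z => _) = (fun z => A (A z) - (A (A z) - M *: z))).
    exact: cvgB.
  by apply/funext => z; rewrite opprB addrC subrK.
pose z := M^-1 *: A y.
have Gz : id @ G --> z.
  rewrite (_ : id = (fun t => M^-1 *: (M *: t))); first exact: cvgZl_tmp.
  by apply/funext => t; rewrite scalerA mulVf // scale1r.
have z1 : `|z| = 1.
  have h : (fun t : H => `|t|) @ G --> `|z| by exact: cvg_norm Gz.
  by apply: (cvg_eventually_cst pG h); apply: filterS GV => t [].
have Vz : V z.
  move=> w Sw; have h : hdot w @ G --> hdot w z by exact: (cvg_hdotr (y := w) Gz).
  by apply: (cvg_eventually_cst pG h); apply: filterS GV => t [Vt _]; exact: Vt.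
have AAz : A (A z) = M *: z.
  have Az : A @ G --> A z by apply: (cvg_comp _ _ Gz); exact: cA.
  have AAz : (fun t => A (A t)) @ G --> A (A z) by apply: (cvg_comp _ _ Az); exact: cA.
  have -> : M *: z = A y by rewrite /z scalerA mulfV // scale1r.
  by have := cvg_lim (@norm_hausdorff _ _) AAz; rewrite (cvg_lim (@norm_hausdorff _ _) AAy) => ->.
clearbody z.
have zn0 : z != 0 by rewrite -normr_eq0 z1 oner_eq0.
pose s := Num.sqrt M.
have ss : s * s = M by rewrite -expr2 sqr_sqrtr.
have [w0|wn0] := eqVneq (A z + s *: z) 0.
  exists z; split=> //; exists (- s); apply/eqP.
  by rewrite scaleNr -addr_eq0 w0.
exists (A z + s *: z); split=> //.
  exists s; rewrite linear_add // linear_scale // AAz scalerDr scalerA ss addrC.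
  by [].
by move=> w Sw; rewrite hdotDr AV // VZ // addr0.
Qed.

Lemma hs_eigenbasis_exists A : separable_space H -> infinite_dimensional H ->
  hilbert_schmidt A -> self_adjoint A -> exists p, eigenbasis A p.
Proof.
move=> hsep hinf [bA hA] sA; apply: eigenbasis_exists => //; last by case: bA.
move=> S x [_ eS] x0 Sx; exact: (hs_eigenvector (onb_basis hsep hinf) bA sA hA eS x0 Sx).
Qed.

End Spectral.

(** The tail of the series at a is dominated termwise by the tail at C. Uniformity over |a| <= C is
    what controls all eigenvalues of an operator at once. *)
Lemma expR_partial_sum_le (R : realType) (a C : R) (n : nat) : `|a| <= C ->
  `|expR a - series (exp_coeff a) n| <= expR C - series (exp_coeff C) n.
Proof.
move=> aC.
have ha : (fun i => `|series (exp_coeff a) i - series (exp_coeff a) n|) @ \oo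
    --> `|expR a - series (exp_coeff a) n|.
  apply: cvg_norm; apply: cvgB; [exact: is_cvg_series_exp_coeff|exact: cvg_cst].
have hC : (fun i => series (exp_coeff C) i - series (exp_coeff C) n) @ \oo
    --> expR C - series (exp_coeff C) n.
  apply: cvgB; [exact: is_cvg_series_exp_coeff|exact: cvg_cst].
rewrite -(cvg_lim _ ha) // -(cvg_lim _ hC) //; apply: ler_lim.
- by apply/cvg_ex; eexists; exact: ha.
- by apply/cvg_ex; eexists; exact: hC.
- exists n => // i /= ni; rewrite !sub_series_geq //.
  apply: le_trans (ler_norm_sum _ _ _) _; apply: ler_sum => k _.
  rewrite /exp_coeff /= normrM normrX normfV (ger0_norm (ler0n _ _)).
  by rewrite ler_wpM2r ?invr_ge0 ?ler0n // lerXn2r ?nnegrE // (le_trans _ aC).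
Qed.

(** * Functional calculus *)

Section DiagonalOperators.
Context {R : realType} {H : realHilbertType R}.
Implicit Types (x y z : H) (T : H -> H) (l m : nat -> R).

(** The body of [spectral_calculus] with the basis and the coefficients made explicit; boundedness
    of l guarantees that the limit exists for every x. *)
Definition diag_op (e : nat -> H) l : H -> H :=
  fun x => limn (series (fun k => (l k * hdot (e k) x) *: e k)).

Definition bounded_coefs l := exists C : R, forall k, `|l k| <= C.

Lemma bounded_coefsM l m : bounded_coefs l -> bounded_coefs m ->
  bounded_coefs (fun k => l k * m k).
Proof.
move=> [C lC] [D mD]; exists (C * D) => k; rewrite normrM ler_pM //.
Qed.

Lemma bounded_coefsB l m : bounded_coefs l -> bounded_coefs m ->
  bounded_coefs (fun k => l k - m k).
Proof.
move=> [C lC] [D mD]; exists (C + D) => k.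
by apply: le_trans (ler_normB _ _) _; rewrite lerD.
Qed.

Lemma bounded_coefs_cst (c : R) : bounded_coefs (fun=> c).
Proof. by exists `|c|. Qed.

Lemma bounded_coefs_itv l c C : (forall k, c <= l k <= C) -> bounded_coefs l.
Proof.
move=> lcC; exists (`|c| + `|C|) => k; have /andP[cl lC] := lcC k.
by rewrite ler_norml; apply/andP; split; have := ler_norm C; have := ler_norm (- c);
  rewrite normrN; have := normr_ge0 C; have := normr_ge0 c; lra.
Qed.

Lemma bounded_coefsX l n : bounded_coefs l -> bounded_coefs (fun k => l k ^+ n).
Proof.
by move=> [C lC]; exists (C ^+ n) => k; rewrite normrX lerXn2r ?nnegrE // (le_trans _ (lC k)).
Qed.

Section Basis.
Variable e : nat -> H.
Hypothesis be : orthonormal_basis e.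
Let oe := basis_orthonormal be.

Lemma diag_op_cvg l x : bounded_coefs l ->
  cvgn (series (fun k => (l k * hdot (e k) x) *: e k)).
Proof.
move=> [C lC]; apply: riesz_fischer => //.
have cx : cvgn (series (C ^+ 2 \*: (fun k => hdot (e k) x ^+ 2))).
  by apply: is_cvg_seriesZ; exact: bessel_cvg.
apply: series_le_cvg cx => n; rewrite ?sqr_ge0 //=.
  by rewrite /GRing.scale /= mulr_ge0 ?sqr_ge0.
rewrite exprMn ler_wpM2r ?sqr_ge0 //.
by rewrite -[leLHS]real_normK ?num_real // lerXn2r ?nnegrE // (le_trans _ (lC n)).
Qed.

Lemma diag_op_coord l x k : bounded_coefs l ->
  hdot (e k) (diag_op e l x) = l k * hdot (e k) x.
Proof.
move=> bl; apply: (orthonormal_coord (c := fun k => l k * hdot (e k) x)) => //.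
exact: diag_op_cvg.
Qed.

Lemma diag_op_unique l x y : bounded_coefs l ->
  (forall k, hdot (e k) y = l k * hdot (e k) x) -> y = diag_op e l x.
Proof.
by move=> bl h; apply: (basis_ext be) => k; rewrite h diag_op_coord.
Qed.

Lemma diag_op_norm_le l C x : (forall k, `|l k| <= C) -> `|diag_op e l x| <= C * `|x|.
Proof.
move=> lC; have bl : bounded_coefs l by exists C.
have C0 : 0 <= C by apply: le_trans (lC 0%N).
rewrite -(@ler_pXn2r _ 2) ?nnegrE ?mulr_ge0 //.
have /cvg_lim <- // := parseval be (diag_op e l x).
apply: limr_le; first by apply/cvg_ex; eexists; exact: parseval.
apply: nearW => n.
apply: (@le_trans _ _ (C ^+ 2 * series (fun k => hdot (e k) x ^+ 2) n)).
  rewrite /series /= mulr_sumr; apply: ler_sum => k _.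
  rewrite diag_op_coord // exprMn ler_wpM2r ?sqr_ge0 //.
  by rewrite -[leLHS]real_normK ?num_real // lerXn2r ?nnegrE.
by rewrite exprMn ler_wpM2l ?sqr_ge0 //; exact: bessel.
Qed.

Lemma diag_op_linear l : bounded_coefs l -> linear (diag_op e l).
Proof.
move=> bl a x y; apply/esym/diag_op_unique => // k.
by rewrite !hdotDr !hdotZr !diag_op_coord //; ring.
Qed.

Lemma diag_op_bounded l : bounded_coefs l -> bounded_operator (diag_op e l).
Proof.
move=> bl; apply/bounded_operatorP; split; first exact: diag_op_linear.
have [C lC] := bl; exists (C + 1) => [|x].
  by rewrite ltr_pwDr // (le_trans _ (lC 0%N)).
by apply: diag_op_norm_le => k; apply: le_trans (lC k) _; rewrite lerDl.
Qed.

Lemma diag_op_hdot l x y : bounded_coefs l ->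
  series (fun k => l k * (hdot (e k) x * hdot (e k) y)) @ \oo --> hdot x (diag_op e l y).
Proof.
move=> bl; have := parseval_hdot be x (diag_op e l y).
by under eq_fun do rewrite diag_op_coord // mulrCA.
Qed.

Arguments diag_op_hdot {l} x y.

Lemma diag_op_self_adjoint l : bounded_coefs l -> self_adjoint (diag_op e l).
Proof.
move=> bl x y; rewrite hdotC; have /cvg_lim <- // := diag_op_hdot y x bl.
rewrite (_ : (fun k => _) = (fun k => l k * (hdot (e k) x * hdot (e k) y))).
  by apply: cvg_lim => //; exact: diag_op_hdot.
by apply/funext => k; rewrite (mulrC (hdot _ y)).
Qed.

Lemma diag_op_basis l k : bounded_coefs l -> diag_op e l (e k) = l k *: e k.
Proof.
move=> bl; apply/esym/diag_op_unique => // j; rewrite hdotZr oe.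
by case: eqP => [->//|_]; rewrite !mulr0.
Qed.

Lemma diag_opM l m x : bounded_coefs l -> bounded_coefs m ->
  diag_op e l (diag_op e m x) = diag_op e (fun k => l k * m k) x.
Proof.
move=> bl bm; apply: diag_op_unique => [|k]; first exact: bounded_coefsM.
by rewrite !diag_op_coord // mulrA.
Qed.

Lemma diag_op_ge l c x : bounded_coefs l -> (forall k, c <= l k) ->
  c * `|x| ^+ 2 <= hdot x (diag_op e l x).
Proof.
move=> bl cl; have h1 := diag_op_hdot x x bl.
have h2 : series (fun k => c * (hdot (e k) x * hdot (e k) x)) @ \oo --> c * `|x| ^+ 2.
  rewrite -hdot_norm.
  rewrite (_ : series _ = (fun n => c * series (fun k => hdot (e k) x * hdot (e k) x) n)).
    by apply: cvgM; [exact: cvg_cst|exact: parseval_hdot].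
  by apply/funext => n; rewrite /series /= mulr_sumr.
rewrite -(cvg_lim _ h1) // -(cvg_lim _ h2) //; apply: ler_lim.
- by apply/cvg_ex; eexists; exact: h2.
- by apply/cvg_ex; eexists; exact: h1.
- by apply: nearW => n; apply: ler_sum => k _; rewrite ler_wpM2r // -expr2 sqr_ge0.
Qed.

Lemma eigen_diag_op T l : self_adjoint T -> (forall k, T (e k) = l k *: e k) ->
  bounded_coefs l -> T = diag_op e l.
Proof.
move=> sT Te bl; apply/funext => x; apply: diag_op_unique => // k.
by rewrite -sT Te hdotZl.
Qed.

Lemma eigenvalue_bounded T l : bounded_operator T -> (forall k, T (e k) = l k *: e k) ->
  bounded_coefs l.
Proof.
move=> /bounded_operatorP[_ [C _ TC]] Te; exists C => k.
by have := TC (e k); rewrite Te normrZ orthonormal_norm // !mulr1.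
Qed.

End Basis.

(** Independence of the eigenbasis chosen by [get]: eigenvectors of a self-adjoint T for different
    eigenvalues are orthogonal, so l'_j = l_k whenever <e'_j, e_k> is nonzero, and both diagonal
    operators agree on each e_k. *)
Lemma spectral_calculusE (e : nat -> H) f T l : orthonormal_basis e -> self_adjoint T -> (forall k, T (e k) = l k *: e k) ->
  bounded_coefs (fun k => f (l k)) ->
  spectral_calculus f T = diag_op e (fun k => f (l k)).
Proof.
move=> be sT Te bfl; rewrite /spectral_calculus.
have : eigenbasis T (get [set p | eigenbasis T p]).
  by apply: (@getPex _ [set p | eigenbasis T p]); exists (e, l).
move: (get _) => [e' l'] [/= be' Te'].
have ll' j k : hdot (e' j) (e k) != 0 -> l' j = l k.
  move=> h; apply: (mulIf h); by rewrite -hdotZl -Te' sT Te hdotZr.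
have bfl' : bounded_coefs (fun k => f (l' k)).
  have [C flC] := bfl; exists C => j.
  (* Each e'_j has a nonzero coordinate along e, so every l'_j is one of the l_k and inherits the
     bound. *)
  suff [k /ll' ->] : exists k, hdot (e' j) (e k) != 0 by [].
  apply: contrapT => /forallNP h; have : e' j = 0.
    apply: (basis_ext be) => k; rewrite hdot0r hdotC.
    by have /negP := h k; rewrite negbK => /eqP.
  move=> /(congr1 (fun x => `|x|)); rewrite (orthonormal_norm _ (basis_orthonormal be')) normr0.
  by move/eqP; rewrite oner_eq0.
rewrite -/(diag_op e' (fun k => f (l' k))).
apply/funext => x; apply: (diag_op_unique be) => // k.
rewrite -(diag_op_self_adjoint be') // -hdotZl; congr (hdot _ x).
apply/esym/(diag_op_unique be') => // j.
rewrite hdotZr; have [->|/ll' -> //] := eqVneq (hdot (e' j) (e k)) 0.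
by rewrite !mulr0.
Qed.


Section FunctionalCalculus.
Variable e : nat -> H.
Hypothesis be : orthonormal_basis e.

Lemma iter_diag_op l n x : bounded_coefs l ->
  iter n (diag_op e l) x = diag_op e (fun k => l k ^+ n) x.
Proof.
move=> bl; elim: n => [|n IH].
  by apply: (diag_op_unique be) => [|k]; [exact: bounded_coefsX|rewrite expr0 mul1r].
rewrite iterS IH diag_opM //; last exact: bounded_coefsX.
by under [in RHS]eq_fun do rewrite exprS.
Qed.

(** The partial sums of the operator series are diagonal, with the scalar partial sums as
    coefficients; the uniform tail bound makes them converge in operator norm. *)
Lemma op_exp_diag l : bounded_coefs l ->
  op_exp (diag_op e l) = diag_op e (fun k => expR (l k)).
Proof.
move=> bl; have [C lC] := bl; apply/funext => x.
have bS n : bounded_coefs (fun k => series (exp_coeff (l k)) n).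
  exists (series (exp_coeff C) n) => k; rewrite /series /=.
  apply: le_trans (ler_norm_sum _ _ _) _; apply: ler_sum => j _.
  rewrite /exp_coeff /= normrM normrX normfV (ger0_norm (ler0n _ _)).
  by rewrite ler_wpM2r ?invr_ge0 ?ler0n // lerXn2r ?nnegrE // (le_trans _ (lC k)).
have bexp : bounded_coefs (fun k => expR (l k)).
  exists (expR C) => k; rewrite ger0_norm ?expR_ge0 // ler_expR.
  exact: le_trans (ler_norm _) (lC k).
have S_diag n : series (fun k => (k`!%:R)^-1 *: iter k (diag_op e l) x) n =
    diag_op e (fun k => series (exp_coeff (l k)) n) x.
  apply: (diag_op_unique be) => // k; rewrite hdot_series /series /= mulr_suml.
  apply: eq_bigr => j _; rewrite iter_diag_op // hdotZr (diag_op_coord be); last exact: bounded_coefsX.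
  by rewrite /exp_coeff /= mulrA (mulrC (l k ^+ j)).
rewrite /op_exp; apply: cvg_lim => //.
apply/cvgrPdist_lt => eps eps0.
have hC : (fun n => expR C - series (exp_coeff C) n) @ \oo --> 0.
  by rewrite -[X in _ --> X](subrr (expR C)); apply: cvgB; [exact: cvg_cst|exact: is_cvg_series_exp_coeff].
have e1 : 0 < eps / (`|x| + 1) by rewrite divr_gt0 // ltr_wpDl.
have /cvgrPdist_lt/(_ _ e1) := hC.
apply: filterS => n; rewrite sub0r normrN => /(le_lt_trans (ler_norm _)).
rewrite ltr_pdivlMr ?ltr_wpDl // => h; apply: le_lt_trans h.
rewrite S_diag.
have -> : diag_op e (fun k => expR (l k)) x - diag_op e (fun k => series (exp_coeff (l k)) n) x =
    diag_op e (fun k => expR (l k) - series (exp_coeff (l k)) n) x.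
  apply: (diag_op_unique be) => [|k]; first exact: bounded_coefsB.
  by rewrite hdotBr !diag_op_coord // mulrBl.
have dC : forall k, `|expR (l k) - series (exp_coeff (l k)) n| <= expR C - series (exp_coeff C) n.
  by move=> k; exact: expR_partial_sum_le.
apply: le_trans (diag_op_norm_le be _ dC) _.
rewrite ler_wpM2l ?lerDl //; exact: le_trans (dC 0%N).
Qed.

Lemma bounded_coefs_ln l c C : 0 < c -> (forall k, c <= l k <= C) ->
  bounded_coefs (fun k => ln (l k)).
Proof.
move=> c0 lcC; apply: (@bounded_coefs_itv _ (ln c) (ln C)) => k.
have /andP[cl lC] := lcC k.
by rewrite !ler_ln ?posrE ?cl ?lC //; lra.
Qed.

Lemma bounded_coefs_powR l c C s : 0 < c -> (forall k, c <= l k <= C) ->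
  bounded_coefs (fun k => l k `^ s).
Proof.
move=> c0 lcC; have [M lM] := bounded_coefs_ln c0 lcC.
exists (expR (`|s| * M)) => k.
have lk0 : 0 < l k by have /andP[cl _] := lcC k; exact: lt_le_trans cl.
rewrite /powR gt_eqF // ger0_norm ?expR_ge0 // ler_expR.
by apply: le_trans (ler_norm _) _; rewrite normrM ler_wpM2l.
Qed.

Section PositiveEigenvalues.
Variables (T : H -> H) (l : nat -> R) (c C : R).
Hypotheses (sT : self_adjoint T) (Te : forall k, T (e k) = l k *: e k).
Hypotheses (c0 : 0 < c) (lcC : forall k, c <= l k <= C).

Lemma op_log_diag : op_log T = diag_op e (fun k => ln (l k)).
Proof. by rewrite /op_log (spectral_calculusE be sT Te) //; exact: bounded_coefs_ln lcC. Qed.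

Lemma op_pow_diag s : op_pow T s = diag_op e (fun k => l k `^ s).
Proof.
have bl := bounded_coefs_ln c0 lcC.
have bsl : bounded_coefs (fun k => s * ln (l k)).
  by apply: bounded_coefsM => //; exact: bounded_coefs_cst.
rewrite /op_pow op_log_diag (_ : (fun x => _) = diag_op e (fun k => s * ln (l k))).
  rewrite op_exp_diag //; congr diag_op; apply/funext => k.
  have lk0 : 0 < l k by have /andP[cl _] := lcC k; exact: lt_le_trans cl.
  by rewrite /powR (gt_eqF lk0).
apply/funext => x; apply: (diag_op_unique be) => // k.
by rewrite hdotZr diag_op_coord // mulrA.
Qed.

End PositiveEigenvalues.
End FunctionalCalculus.
End DiagonalOperators.

(** * Hilbert-Schmidt and trace-class operators *)

Section ScalarParts.
Context {R : realType} {H : realHilbertType R}.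
Hypotheses (hsep : separable_space H) (hinf : infinite_dimensional H).
Implicit Types (x y z : H) (A B T : H -> H) (l : nat -> R) (g : R).
Let bo : orthonormal_basis (onb H) := onb_basis hsep hinf.

Lemma hilbert_schmidt_basis f A : orthonormal_basis f -> bounded_operator A ->
  self_adjoint A -> cvgn (series (fun k => `|A (f k)| ^+ 2)) ->
  hilbert_schmidt A /\ hs_norm A ^+ 2 = limn (series (fun k => `|A (f k)| ^+ 2)).
Proof.
move=> bf bA sA cA; have [co eo] := square_sum_basis_indep bf bo sA cA.
by split=> //; rewrite /hs_norm sqr_sqrtr ?eo // nneg_series_lim_ge0 // => k; exact: sqr_ge0.
Qed.

Lemma square_norm_cvg0 (u : nat -> H) :
  (fun k => `|u k| ^+ 2) @ \oo --> 0 -> u @ \oo --> 0.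
Proof.
move=> /cvgrPdist_lt h; apply/cvgrPdist_lt => e e0.
have e2 : 0 < e ^+ 2 by rewrite exprn_gt0.
apply: filterS (h _ e2) => k; rewrite !sub0r !normrN ger0_norm ?sqr_ge0 //.
by rewrite ltr_pXn2r ?nnegrE // ltW.
Qed.

Lemma hilbert_schmidt_cvg0 A : hilbert_schmidt A -> (fun k => A (onb H k)) @ \oo --> 0.
Proof. by move=> [_ cA]; apply: square_norm_cvg0; exact: cvg_series_cvg_0. Qed.

Lemma absolute_value_norm A B x : is_absolute_value A B -> `|B x| = `|A x|.
Proof.
move=> [bB sB _ BA]; apply/eqP; rewrite -(@eqrXn2 _ 2) //; apply/eqP.
by rewrite -!hdot_norm -sB BA.
Qed.

(** |A x| = |B x| for the absolute value B, and Cauchy-Schwarz for the form of B gives |B x|^2 <= C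
    <x, B x>, the general term of a convergent series along the basis. This is all that uniqueness
    of the scalar part requires of trace class. *)
Lemma trace_class_cvg0 A : trace_class A -> (fun k => A (onb H k)) @ \oo --> 0.
Proof.
move=> [_ [B AB cB]]; have [bB sB pB _] := AB; apply: square_norm_cvg0.
have [lB [C C0 BC]] := (bounded_operatorP B).1 bB.
have hB x : `|B x| ^+ 2 <= C * hdot x (B x).
  have [->|Bx0] := eqVneq (B x) 0; first by rewrite normr0 expr0n hdot0r mulr0.
  have N0 : 0 < `|B x| ^+ 2 by rewrite exprn_gt0 // normr_gt0.
  have := cauchy_schwarz_pos lB sB pB (B x) x; rewrite hdot_norm.
  have : hdot (B x) (B (B x)) <= C * `|B x| ^+ 2.
    apply: le_trans (ler_norm _) _; apply: le_trans (cauchy_schwarz _ _) _.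
    by rewrite expr2 mulrCA ler_wpM2l.
  move=> h1 h2; rewrite -(ler_pM2l N0) -expr2; have p0 := pB x.
  by apply: le_trans h2 _; rewrite mulrA (mulrC _ C) ler_wpM2r.
apply: (@squeeze_cvgr _ _ _ _ (fun=> 0) (fun k => C * hdot (onb H k) (B (onb H k)))).
- by apply: nearW => k; rewrite sqr_ge0 -(absolute_value_norm _ AB) hB.
- exact: cvg_cst.
- rewrite -[X in _ --> X](mulr0 C); apply: cvgM; first exact: cvg_cst.
  exact: cvg_series_cvg_0.
Qed.

(** The two sequences differ by a multiple of e_k of constant norm |g - g'|. Infinite dimension
    enters through the infinite sequence of basis vectors. *)
Lemma scalar_part_unique T g g' :
  (fun k => plus_scalar T (- g) (onb H k)) @ \oo --> 0 ->
  (fun k => plus_scalar T (- g') (onb H k)) @ \oo --> 0 -> g = g'.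
Proof.
move=> h h'; have hd : (fun k => `|plus_scalar T (- g) (onb H k) - plus_scalar T (- g') (onb H k)|) @ \oo
    --> `|(0 : H) - 0|.
  by apply: cvg_norm; exact: cvgB.
apply/eqP; rewrite -subr_eq0 -normr_eq0; apply/eqP.
rewrite subrr normr0 in hd; rewrite -(cvg_lim _ hd) //; apply/esym/lim_near_cst => //.
apply: nearW => k; rewrite /plus_scalar opprD addrACA subrr add0r !scaleNr opprK addrC.
by rewrite -scalerBl normrZ (orthonormal_norm _ (basis_orthonormal bo)) mulr1 distrC.
Qed.

Lemma hs_scalar_partE T g : hilbert_schmidt (plus_scalar T (- g)) -> hs_scalar_part T = g.
Proof.
move=> h; apply: (@scalar_part_unique T); apply: hilbert_schmidt_cvg0 => //.
by apply: (@getPex _ [set g : R | hilbert_schmidt (plus_scalar T (- g))]); exists g.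
Qed.

Lemma tr_scalar_partE T g : trace_class (plus_scalar T (- g)) -> tr_scalar_part T = g.
Proof.
move=> h; apply: (@scalar_part_unique T); apply: trace_class_cvg0 => //.
by apply: (@getPex _ [set g : R | trace_class (plus_scalar T (- g))]); exists g.
Qed.

Lemma nneg_summable_bounded l : (forall k, 0 <= l k) -> cvgn (series l) -> bounded_coefs l.
Proof.
move=> l0 cl; exists (limn (series l)) => k; rewrite ger0_norm //.
exact: nneg_series_term_le_lim.
Qed.

(** With nonnegative coefficients the operator is its own absolute value. Its trace along [onb] is
    bounded by the sum of l: exchange finite sums and apply Bessel to each f_j. *)
Lemma diag_op_trace_class (f : nat -> H) l : orthonormal_basis f -> (forall k, 0 <= l k) ->
  cvgn (series l) -> trace_class (diag_op f l).
Proof.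
move=> bf l0 cl; have bl := nneg_summable_bounded l0 cl.
have pos x : 0 <= hdot x (diag_op f l x).
  by have := diag_op_ge bf (c := 0) x bl l0; rewrite mul0r.
split; first exact: diag_op_bounded.
exists (diag_op f l).
  split=> //; [exact: diag_op_bounded|exact: diag_op_self_adjoint|].
  by move=> x y; rewrite (diag_op_self_adjoint bf bl).
apply: (@nneg_series_bounded_cvg _ _ (limn (series l))) => // n.
have hc : (fun i => \sum_(0 <= k < n) series (fun j => l j * (hdot (f j) (onb H k) * hdot (f j) (onb H k))) i) @ \oo
   --> \sum_(0 <= k < n) hdot (onb H k) (diag_op f l (onb H k)).
  by apply: cvg_finite_sum => k; exact: diag_op_hdot.
rewrite /series /= -(cvg_lim _ hc) //; apply: limr_le; first by apply/cvg_ex; eexists; exact: hc.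
apply: nearW => i; rewrite /series /= exchange_big /=.
apply: le_trans (nneg_series_le_lim i l0 cl); rewrite /series /=.
apply: ler_sum => j _; rewrite -mulr_sumr -[leRHS]mulr1 ler_wpM2l //.
have := bessel (f j) n (basis_orthonormal bo).
rewrite (orthonormal_norm _ (basis_orthonormal bf)) expr1n; apply: le_trans.
by rewrite /series /=; apply: ler_sum => k _; rewrite -expr2 hdotC.
Qed.

End ScalarParts.

(** * The relative operator *)

Lemma is_cvg_series_comb (R : realType) (u v : R^nat) (a b : R) :
  cvgn (series u) -> cvgn (series v) -> cvgn (series (fun k => a * u k + b * v k)).
Proof.
by move=> cu cv; exact: is_cvg_seriesD (is_cvg_seriesZ cu) (is_cvg_seriesZ cv).
Qed.

Section PositiveDefinite.
Context {R : realType} {H : realHilbertType R}.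
Hypotheses (hsep : separable_space H) (hinf : infinite_dimensional H).
Implicit Types (x y z : H) (A B T : H -> H) (l : nat -> R) (g m : R).
Let bo : orthonormal_basis (onb H) := onb_basis hsep hinf.

(** Membership in [PC2] read on eigenvalues: positive definiteness gives c, boundedness gives C, and
    the Hilbert-Schmidt condition gives the summability. *)
Definition pd_spectrum g l :=
  (exists c C, 0 < c /\ forall k, c <= l k <= C) /\
  cvgn (series (fun k => (l k - g) ^+ 2)).

Lemma plus_scalar_self_adjoint A g : self_adjoint A -> self_adjoint (plus_scalar A g).
Proof. by move=> sA x y; rewrite /plus_scalar hdotDl hdotDr sA hdotZl hdotZr. Qed.

Lemma PC2_spectrum A g (e : nat -> H) l : PC2 A g -> eigenbasis (plus_scalar A g) (e, l) ->
  pd_spectrum g l.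
Proof.
move=> [[bA hA] sA [_ [c c0 hc]]] [/= be Te].
have Ae k : A (e k) = (l k - g) *: e k.
  by have := Te k; rewrite /plus_scalar scalerBl => <-; rewrite addrK.
have [hAe _] := square_sum_basis_indep bo be sA hA.
have ne k : `|e k| = 1 by exact: orthonormal_norm (basis_orthonormal be).
split; last first.
  rewrite (_ : (fun k => _) = (fun k => `|A (e k)| ^+ 2)) //.
  by apply/funext => k; rewrite Ae normrZ ne mulr1 real_normK ?num_real.
have [D lD] : bounded_coefs (fun k => l k - g) by apply: (eigenvalue_bounded be bA).
exists c, (g + D); split=> // k; apply/andP; split.
  by have := hc (e k); rewrite Te hdotZr hdot_norm ne expr1n !mulr1.
by have := le_trans (ler_norm _) (lD k); lra.
Qed.

Lemma PC2_eigenbasis A g : PC2 A g -> exists e l, eigenbasis (plus_scalar A g) (e, l).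
Proof.
move=> [hA sA _]; have [[e a] [/= be Ae]] := hs_eigenbasis_exists hsep hinf hA sA.
by exists e, (fun k => a k + g); split=> //= k; rewrite /plus_scalar Ae scalerDl.
Qed.

Lemma pd_spectrum_gt0 g l k : pd_spectrum g l -> 0 < l k.
Proof. by move=> [[c [C [c0 /(_ k)/andP[cl _]]]] _]; exact: lt_le_trans cl. Qed.

(** The eigenvalues stay above c > 0 and tend to g; one of them within c of g is enough. *)
Lemma PC2_gt0 A g : PC2 A g -> 0 < g.
Proof.
move=> pA; have [e [l el]] := PC2_eigenbasis pA.
have [[c [C [c0 lcC]]] /cvg_series_cvg_0/cvgrPdist_lt h] := PC2_spectrum pA el.
have [N _ /(_ N (leqnn N))/=] := h _ (exprn_gt0 2 c0).
have /andP[cl _] := lcC N.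
rewrite sub0r normrN ger0_norm ?sqr_ge0 // -[X in X < _]real_normK ?num_real //.
rewrite ltr_pXn2r ?nnegrE ?(ltW c0) // ltr_norml; lra.
Qed.

Lemma bounded_operator_comp A B : bounded_operator A -> bounded_operator B ->
  bounded_operator (fun x => A (B x)).
Proof.
move=> /bounded_operatorP[lA [C C0 AC]] /bounded_operatorP[lB [D D0 BD]].
apply/bounded_operatorP; split=> [a x y|]; first by rewrite lB lA.
exists (C * D) => [|x]; first exact: mulr_gt0.
by apply: le_trans (AC _) _; rewrite -mulrA ler_wpM2l // ltW.
Qed.

Lemma bounded_operator_add A B : bounded_operator A -> bounded_operator B ->
  bounded_operator (fun x => A x + B x).
Proof.
move=> /bounded_operatorP[lA [C C0 AC]] /bounded_operatorP[lB [D D0 BD]].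
apply/bounded_operatorP; split=> [a x y|].
  by rewrite lB lA scalerDr addrACA.
exists (C + D) => [|x]; first exact: addr_gt0.
by apply: le_trans (ler_normD _ _) _; rewrite mulrDl lerD.
Qed.

Lemma powRN2_sqr (a : R) : 0 < a -> a `^ (- 2^-1) * a `^ (- 2^-1) = a^-1.
Proof.
move=> a0; rewrite -powRD; last by rewrite (gt_eqF a0) ?implybT.
by rewrite (_ : - 2^-1 - 2^-1 = -1 :> R); [rewrite powR_inv1 // ltW|field].
Qed.

Lemma powR2_sqr (a : R) : 0 < a -> a `^ (2^-1) * a `^ (2^-1) = a.
Proof.
move=> a0; rewrite -powRD; last by rewrite (gt_eqF a0) ?implybT.
by rewrite (_ : 2^-1 + 2^-1 = 1 :> R); [rewrite powRr1 // ltW|field].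
Qed.

(** With Q = (B + m I)^(-1/2), Q (A + g I) Q = Q A Q + g Q^2, and Q^2 differs from m^-1 I by a
    diagonal operator with coefficients (m - u_k) / (u_k m), which are square summable. So L = Q A Q
    + g (Q^2 - m^-1 I). *)
Lemma relative_op_PC2 A g B m : PC2 A g -> PC2 B m ->
  exists2 L, PC2 L (g / m) & relative_op A g B m = plus_scalar L (g / m).
Proof.
move=> pA pB; have m0 := PC2_gt0 pB.
have [[bA hA] sA [_ [M M0 hM]]] := pA.
have [f [u fu]] := PC2_eigenbasis pB.
have us := PC2_spectrum pB fu; have [[c [C [c0 ucC]]] hu] := us.
have [/= bf Bf] := fu.
have u0 k : 0 < u k := pd_spectrum_gt0 k us.
have sB : self_adjoint (plus_scalar B m) by apply: plus_scalar_self_adjoint; case: pB.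
set q := fun k => u k `^ (- 2^-1).
have bq : bounded_coefs q by exact: bounded_coefs_powR ucC.
pose Q := diag_op f q.
have QE : op_pow (plus_scalar B m) (- 2^-1) = Q by exact: (op_pow_diag bf sB Bf c0 ucC).
have sQ : self_adjoint Q by exact: diag_op_self_adjoint.
have bQ : bounded_operator Q by exact: diag_op_bounded.
have buV : bounded_coefs (fun k => (u k)^-1).
  by have := bounded_coefsM bq bq; congr bounded_coefs; apply/funext => k; exact: powRN2_sqr.
have QQ x : Q (Q x) = diag_op f (fun k => (u k)^-1) x.
  by rewrite /Q diag_opM //; congr diag_op; apply/funext => k; exact: powRN2_sqr.
pose d k := (u k)^-1 - m^-1.
have bd : bounded_coefs d by apply: bounded_coefsB => //; exact: bounded_coefs_cst.
pose D := diag_op f (fun k => g * d k).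
have bgd : bounded_coefs (fun k => g * d k) by apply: bounded_coefsM => //; exact: bounded_coefs_cst.
pose L x := Q (A (Q x)) + D x.
have LE x : Q (plus_scalar A g (Q x)) = L x + (g / m) *: x.
  have [lQ _] := bQ; rewrite /plus_scalar linear_add // linear_scale // QQ /L -addrA; congr (_ + _).
  apply: (basis_ext bf) => k; rewrite hdotDr !hdotZr !diag_op_coord //; rewrite /d; ring.
have bL : bounded_operator L.
  by apply: bounded_operator_add; [apply: bounded_operator_comp => //; exact: bounded_operator_comp|exact: diag_op_bounded].
have sL : self_adjoint L.
  move=> x y; rewrite /L hdotDl hdotDr; congr (_ + _); first by rewrite sQ sA sQ.
  exact: diag_op_self_adjoint.
exists L; last by rewrite /relative_op QE; apply/funext => x; exact: LE.
split => //.
- apply: (hilbert_schmidt_basis hsep hinf bf bL sL _).1.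
  have [hAf _] := square_sum_basis_indep bo bf sA hA.
  have [_ [K K0 QK]] := (bounded_operatorP Q).1 bQ.
  have [lQ _] := bQ; have [lA _] := bA.
  (* The 2 comes from [sqr_normD_le]. In a1 one K^2 bounds the outer Q and the other the eigenvalue
     of Q at f_k; a2 uses u_k m >= c m. *)
  pose a1 := 2 * (K ^+ 2 * K ^+ 2); pose a2 := 2 * (g ^+ 2 / (c * m) ^+ 2).
  have h : cvgn (series (fun k => a1 * `|A (f k)| ^+ 2 + a2 * (u k - m) ^+ 2)).
    exact: is_cvg_series_comb.
  apply: series_le_cvg h => k; rewrite ?sqr_ge0 //=.
    rewrite addr_ge0 // mulr_ge0 ?sqr_ge0 //.
    + by rewrite /a1; apply: mulr_ge0 => //; apply: mulr_ge0; exact: sqr_ge0.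
    + by rewrite /a2; apply: mulr_ge0 => //; apply: mulr_ge0; rewrite ?invr_ge0 sqr_ge0.
  apply: le_trans (sqr_normD_le _ _) _; rewrite mulrDr; apply: lerD.
    rewrite /a1 -mulrA ler_wpM2l //.
    rewrite /Q diag_op_basis // -/Q linear_scale // linear_scale // normrZ exprMn -mulrA.
    apply: ler_pM; rewrite ?sqr_ge0 //.
      have := QK (f k); rewrite /Q diag_op_basis // normrZ (orthonormal_norm _ (basis_orthonormal bf)) !mulr1.
      by move=> h; rewrite lerXn2r ?nnegrE // ltW.
    by rewrite -exprMn lerXn2r ?nnegrE ?mulr_ge0 // ltW.
  rewrite /a2 -mulrA ler_wpM2l //.
  rewrite /D diag_op_basis // normrZ (orthonormal_norm _ (basis_orthonormal bf)) mulr1.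
  rewrite real_normK ?num_real // exprMn -mulrA ler_wpM2l ?sqr_ge0 //.
  have -> : d k = - (u k - m) / (u k * m).
    by rewrite /d; field; rewrite !gt_eqF.
  rewrite exprMn sqrrN mulrC exprVn ler_wpM2r ?sqr_ge0 // lef_pV2 ?posrE ?exprn_gt0 ?mulr_gt0 //.
  have /andP[cu _] := ucC k.
  by rewrite lerXn2r ?nnegrE ?(mulr_ge0 (ltW _) (ltW _)) ?ler_wpM2r ?(ltW m0).
- split; first exact: plus_scalar_self_adjoint.
  have [C0 uC] : 0 < C /\ forall k, C^-1 <= (u k)^-1.
    have C0 : 0 < C by have /andP[a b] := ucC 0%N; exact: lt_le_trans (le_trans a b).
    by split=> // k; have /andP[a b] := ucC k; rewrite lef_pV2 ?posrE.
  (* <Q x, (A + g I) Q x> >= M |Q x|^2 = M <x, Q^2 x>, and the eigenvalues u_k^-1 of Q^2 are at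
     least C^-1. *)
  exists (M * C^-1) => [|x]; first by rewrite mulr_gt0 ?invr_gt0.
  rewrite /plus_scalar -LE -sQ; apply: le_trans (hM (Q x)).
  rewrite -mulrA ler_wpM2l ?(ltW M0) // -(hdot_norm (Q x)) sQ QQ.
  exact: diag_op_ge.
Qed.

(* With [X = A + g I] and [Y = B + m I], [Y^(-1/2) X Y^(-1/2) f = l f] implies that
   [X^(1/2) Y^(-1/2) f] is an eigenvector of [X^(-1/2) Y X^(-1/2)] for [l^-1]. *)
Lemma relative_op_swap_eigenbasis A g B m (f : nat -> H) l : PC2 A g -> PC2 B m ->
  eigenbasis (relative_op A g B m) (f, l) -> (forall k, 0 < l k) ->
  exists f', eigenbasis (relative_op B m A g) (f', fun k => (l k)^-1).
Proof.
move=> pA pB [/= bf Lf] l0.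
have [a [v av]] := PC2_eigenbasis pA; have vs := PC2_spectrum pA av.
have [[c [C [c0 vcC]]] _] := vs; have [/= ba Aa] := av.
have [b [u bu]] := PC2_eigenbasis pB; have us := PC2_spectrum pB bu.
have [[c' [C' [c0' ucC]]] _] := us; have [/= bb Bb] := bu.
have sA : self_adjoint (plus_scalar A g) by apply: plus_scalar_self_adjoint; case: pA.
have sB : self_adjoint (plus_scalar B m) by apply: plus_scalar_self_adjoint; case: pB.
have XE := eigen_diag_op ba sA Aa (bounded_coefs_itv vcC).
have YE := eigen_diag_op bb sB Bb (bounded_coefs_itv ucC).
have PE := op_pow_diag ba sA Aa c0 vcC (- 2^-1).
have QE := op_pow_diag bb sB Bb c0' ucC (- 2^-1).
have bp := bounded_coefs_powR (- 2^-1) c0 vcC.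
have bs := bounded_coefs_powR (2^-1) c0 vcC.
have bq := bounded_coefs_powR (- 2^-1) c0' ucC.
move: Lf; rewrite /relative_op PE QE XE YE.
set X := diag_op a v; set Y := diag_op b u; set P := diag_op a _; set Q := diag_op b _.
(* S is X^(1/2); it enters only through P S = I and S S = X. *)
pose S := diag_op a (fun k => v k `^ (2^-1)) => Lf.
have PS x : P (S x) = x.
  rewrite /P /S diag_opM //; apply/esym/(diag_op_unique ba) => [|k]; first exact: bounded_coefsM.
  by rewrite powRN mulVf ?mul1r // gt_eqF // powR_gt0 // (pd_spectrum_gt0 k vs).
have SS x : S (S x) = X x.
  rewrite /S diag_opM //; congr diag_op; apply/funext => k.
  exact/powR2_sqr/(pd_spectrum_gt0 k vs).
have YQQ x : Y (Q (Q x)) = x.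
  have bqq := bounded_coefsM bq bq.
  rewrite /Q diag_opM // /Y diag_opM //; last exact: bounded_coefs_itv ucC.
  apply/esym/(diag_op_unique bb) => [|k].
    by apply: bounded_coefsM => //; exact: bounded_coefs_itv ucC.
  have u0 := pd_spectrum_gt0 k us.
  by rewrite powRN2_sqr // mulfV ?mul1r // gt_eqF.
have sQ : self_adjoint Q by exact: diag_op_self_adjoint.
have sS : self_adjoint S by exact: diag_op_self_adjoint.
have lS : linear S by apply: diag_op_linear.
have lP : linear P by apply: diag_op_linear.
have lY : linear Y by apply: diag_op_linear => //; exact: bounded_coefs_itv ucC.
have lQ : linear Q by apply: diag_op_linear.
pose h k := Num.sqrt (l k); have h0 k : 0 < h k by rewrite sqrtr_gt0.
have hh k : h k * h k = l k by rewrite -expr2 sqr_sqrtr // ltW.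
(* The normalization is forced by |S Q f_k|^2 = <f_k, Q X Q f_k> = l_k. *)
pose w k := (h k)^-1 *: S (Q (f k)).
exists w; split=> /= [|k].
  apply: complete_orthonormal_basis => [i j|x hx].
    rewrite /w hdotZl hdotZr sS SS sQ Lf hdotZr (basis_orthonormal bf) mulrA.
    case: eqP => [->|_]; last by rewrite !mulr0.
    by rewrite /= !mulr1 -(hh j) -invfM mulVf // mulf_neq0 // gt_eqF.
  (* Completeness: a vector orthogonal to all w_k is killed by Q S, and both factors have left
     inverses. *)
  have QS0 : Q (S x) = 0.
    apply: (basis_ext bf) => k; rewrite hdot0r -sQ -sS.
    have := hx k; rewrite /w hdotZl => /eqP; rewrite mulf_eq0 invr_eq0 gt_eqF //=.
    by move/eqP.
  have S0 : S x = 0 by rewrite -[S x]YQQ QS0 (linear_0 lQ) (linear_0 lY).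
  by rewrite -[x]PS S0 (linear_0 lP).
have YQ : Y (Q (f k)) = (l k)^-1 *: X (Q (f k)).
  rewrite -[X (Q _)]YQQ Lf (linear_scale _ _ lQ) (linear_scale _ _ lY) scalerA mulVf ?scale1r //.
  by rewrite gt_eqF.
rewrite /w (linear_scale _ _ lP) PS (linear_scale _ _ lY) YQ !(linear_scale _ _ lP) -SS PS.
by rewrite !scalerA mulrC.
Qed.

End PositiveDefinite.

(** * Fredholm determinants *)

Section Determinants.
Context {R : realType}.

(** Sylvester's identity: multiplying U by the same unitriangular block matrix on the right and on
    the left makes it block triangular in two ways. *)
Lemma det_1_mulmxC m n (A : 'M[R]_(m, n)) (B : 'M[R]_(n, m)) :
  \det (1%:M + A *m B) = \det (1%:M + B *m A).
Proof.
pose U : 'M[R]_(m + n) := block_mx 1%:M A (- B) 1%:M.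
have e1 : U *m block_mx 1%:M 0 B 1%:M = block_mx (1%:M + A *m B) A 0 1%:M.
  by rewrite mulmx_block !mulmx1 !mulmx0 !mul1mx !add0r addNr.
have e2 : block_mx 1%:M 0 B 1%:M *m U = block_mx 1%:M A 0 (1%:M + B *m A).
  by rewrite mulmx_block !mulmx1 !mul0mx !mul1mx !addr0 subrr addrC.
have := congr1 (@determinant _ _) e1; have := congr1 (@determinant _ _) e2.
rewrite !det_mulmx !det_lblock !det_ublock !det1 !mul1r !mulr1 => -> <-.
by [].
Qed.

Lemma row_norm_ge0 n (u : 'rV[R]_n) : 0 <= (u *m u^T) 0 0.
Proof. by rewrite mxE sumr_ge0 // => i _; rewrite !mxE -expr2 sqr_ge0. Qed.

(** Y >= I as quadratic forms. It persists under nonnegative rank-one updates and yields v Y^-1 v^T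
    <= v v^T. *)
Definition above_identity n (Y : 'M[R]_n) :=
  forall u : 'rV[R]_n, (u *m u^T) 0 0 <= (u *m Y *m u^T) 0 0.

Lemma above_identity_rank1 n (Y : 'M[R]_n) (v : 'rV[R]_n) k : 0 <= k ->
  above_identity Y -> above_identity (Y + k *: (v^T *m v)).
Proof.
move=> k0 Y1 u; rewrite mulmxDr mulmxDl [leRHS]mxE; apply: (le_trans (Y1 u)).
rewrite lerDl -scalemxAr -scalemxAl mxE mulr_ge0 //.
have -> : u *m (v^T *m v) *m u^T = (u *m v^T) *m (u *m v^T)^T.
  by rewrite trmx_mul trmxK !mulmxA.
exact: row_norm_ge0.
Qed.

(** By Sylvester's identity the determinant is multiplied by 1 + k q, where q = v Y^-1 v^T. With w =
    v Y^-1, the form inequality gives |w|^2 <= q, and 0 <= |v - w|^2 = |v|^2 - 2 q + |w|^2 then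
    gives q <= |v|^2. *)
Lemma det_rank1_update n (Y : 'M[R]_n) (v : 'rV[R]_n) k : 0 <= k ->
  above_identity Y -> 0 < \det Y ->
  \det Y <= \det (Y + k *: (v^T *m v)) <= \det Y * (1 + k * (v *m v^T) 0 0).
Proof.
move=> k0 Y1 dY.
have uY : Y \in unitmx by rewrite unitmxE unitfE gt_eqF.
pose w := v *m invmx Y.
have vE : v = w *m Y by rewrite mulmxKV.
clearbody w.
pose q := (w *m v^T) 0 0.
have -> : Y + k *: (v^T *m v) = (1%:M + (k *: v^T) *m w) *m Y.
  by rewrite mulmxDl mul1mx -mulmxA -vE -scalemxAl.
rewrite det_mulmx det_1_mulmxC det_mx11.
have -> : (1%:M + w *m (k *: v^T)) 0 0 = 1 + k * q.
  by rewrite mxE -scalemxAr; congr (_ + _); rewrite mxE ?eqxx.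
have qE : (v *m w^T) 0 0 = q.
  have -> : v *m w^T = (w *m v^T)^T by rewrite trmx_mul trmxK.
  by rewrite mxE.
have wq : (w *m w^T) 0 0 <= q.
  by have := Y1 w; rewrite -vE qE.
have q0 : 0 <= q by apply: le_trans wq; exact: row_norm_ge0.
have qv : q <= (v *m v^T) 0 0.
  have := row_norm_ge0 (v - w).
  have -> : (v - w) *m (v - w)^T = v *m v^T - v *m w^T - (w *m v^T - w *m w^T).
    by rewrite linearB /= mulmxBl !mulmxBr.
  have entB (C D : 'M[R]_1) : (C - D) 0 0 = C 0 0 - D 0 0 by rewrite !mxE.
  rewrite !entB qE -/q; lra.
rewrite mulrC; apply/andP; split.
  by rewrite -[leLHS]mulr1 ler_pM2l // lerDl mulr_ge0.
by rewrite ler_pM2l // lerD2l ler_wpM2l.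
Qed.

Lemma det_cvg (T : Type) (F : set_system T) (FF : Filter F) n (M : T -> 'M[R]_n) (L : 'M[R]_n) :
  (forall i j, (fun t => M t i j) @ F --> L i j) -> (fun t => \det (M t)) @ F --> \det L.
Proof.
move=> ML; rewrite /determinant; apply: cvg_big => [|s _]; first exact: add_continuous.
by apply: cvgM; [exact: cvg_cst|apply: cvg_big => //; exact: mul_continuous].
Qed.

End Determinants.

(** * The Fredholm determinant of the identity plus a nonnegative trace-class operator *)

Section FredholmDeterminant.
Context {R : realType} {H : realHilbertType R}.
Hypotheses (hsep : separable_space H) (hinf : infinite_dimensional H).
Variables (f : nat -> H) (l : nat -> R).
Hypotheses (bf : orthonormal_basis f) (l0 : forall k, 0 <= l k) (cl : cvgn (series l)).
Let bo : orthonormal_basis (onb H) := onb_basis hsep hinf.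
Let bl : bounded_coefs l := nneg_summable_bounded l0 cl.

Let coords n k : 'rV[R]_n := \row_j hdot (f k) (onb H j).

(** The section of size n along [onb] of the identity plus the rank-N truncation of the operator.
    Keeping n and N apart allows either limit to be taken first. *)
Let section n N : 'M[R]_n := \matrix_(i < n, j < n)
  ((i == j)%:R + series (fun k => l k * (hdot (f k) (onb H i) * hdot (f k) (onb H j))) N).

Let section0 n : section n 0 = 1%:M.
Proof. by apply/matrixP => i j; rewrite !mxE /series /= big_geq // addr0. Qed.

Let sectionS n N : section n N.+1 = section n N + l N *: ((coords n N)^T *m coords n N).
Proof.
by apply/matrixP => i j; rewrite !mxE seriesSr big_ord1 !mxE addrA.
Qed.

Let coords_norm n k : (coords n k *m (coords n k)^T) 0 0 <= 1.
Proof.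
have := bessel (f k) n (basis_orthonormal bo).
rewrite (orthonormal_norm _ (basis_orthonormal bf)) expr1n; apply: le_trans.
rewrite mxE /series /= big_mkord; apply: ler_sum => j _.
by rewrite !mxE hdotC -expr2.
Qed.

Let prod_partial N := \prod_(0 <= k < N) (1 + l k).

(* The sections of the finite-rank truncations are built from the identity by
   rank-one updates; each one increases the determinant by a factor of at most
   [1 + l N]. *)
Let section_bounds n N : [/\ above_identity (section n N), 0 < \det (section n N) &
  \det (section n N) <= prod_partial N].
Proof.
elim: N => [|N [IHa IHd IHp]].
  by rewrite section0 det1 /prod_partial big_geq //; split=> // u; rewrite mulmx1.
have /andP[h1 h2] := det_rank1_update (coords n N) (l0 N) IHa IHd.
rewrite sectionS; split; first exact: above_identity_rank1.
  exact: lt_le_trans h1.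
apply: (le_trans h2); rewrite /prod_partial big_nat_recr //=.
apply: ler_pM => //; first exact: ltW.
  by rewrite addr_ge0 // mulr_ge0 //; exact: row_norm_ge0.
by rewrite lerD2l -[leRHS]mulr1 ler_wpM2l // coords_norm.
Qed.

Let section_mono n : {homo (fun N => \det (section n N)) : M N / (M <= N)%N >-> M <= N}.
Proof.
apply/nondecreasing_seqP => N.
have [IHa IHd _] := section_bounds n N.
by have /andP[] := det_rank1_update (coords n N) (l0 N) IHa IHd; rewrite sectionS.
Qed.

Let fredholm_section n : 'M[R]_n := \matrix_(i < n, j < n)
  ((i == j)%:R + hdot (onb H i) (diag_op f l (onb H j))).

Let section_cvg n : (fun N => \det (section n N)) @ \oo --> \det (fredholm_section n).
Proof.
apply: det_cvg => i j; rewrite mxE; under eq_fun do rewrite mxE.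
apply: cvgD; first exact: cvg_cst.
exact: diag_op_hdot.
Qed.

(* For a fixed truncation, [det (1 + B C) = det (1 + C B)] moves the limit in [n] to
   a matrix of fixed size, which converges to a diagonal one by Parseval. *)
Let section_cvg_prod N : (fun n => \det (section n N)) @ \oo --> prod_partial N.
Proof.
pose B n : 'M[R]_(n, N) := \matrix_(i, k) (l k * hdot (f k) (onb H i)).
pose C n : 'M[R]_(N, n) := \matrix_(k, j) hdot (f k) (onb H j).
have sE n : section n N = 1%:M + B n *m C n.
  apply/matrixP => i j; rewrite !mxE; congr (_ + _).
  by rewrite /series /= big_mkord; apply: eq_bigr => k _; rewrite !mxE mulrA.
under eq_fun do rewrite sE det_1_mulmxC.
have -> : prod_partial N = \det (diag_mx (\row_(k < N) (1 + l k))).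
  by rewrite det_diag /prod_partial big_mkord; apply: eq_bigr => k _; rewrite mxE.
apply: det_cvg => k k'.
rewrite (_ : diag_mx _ k k' = (k == k')%:R + l k' * hdot (f k') (f k)); last first.
  rewrite !mxE (basis_orthonormal bf) -val_eqE eq_sym.
  by case: eqP => [->|_]; rewrite ?mulr1 ?mulr0 ?addr0 //= mulr1.
rewrite (_ : (fun n => _) = (fun n => (k == k')%:R +
    l k' * series (fun i => hdot (onb H i) (f k') * hdot (onb H i) (f k)) n)).
  apply: cvgD; first exact: cvg_cst.
  by apply: cvgM; [exact: cvg_cst|exact: parseval_hdot].
apply/funext => n; rewrite !mxE; congr (_ + _).
rewrite /series /= big_mkord mulr_sumr; apply: eq_bigr => i _.
by rewrite /C /B !mxE !(hdotC (onb H i)); ring.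
Qed.

Lemma ln1D_summable : cvgn (series (fun k => ln (1 + l k))).
Proof.
apply: series_le_cvg cl => k //; first by rewrite ln_ge0 // lerDl.
by apply: le_ln1Dx; apply: lt_le_trans (l0 k); rewrite ltrN10.
Qed.

(** A double limit handled by monotonicity in N: det (section n N) <= det (fredholm_section n) <= P,
    where the left side tends to the N-th partial product as n grows, and that product is close to P
    for a suitable N. *)
Lemma fredholm_det_diag :
  fredholm_det (diag_op f l) = expR (limn (series (fun k => ln (1 + l k)))).
Proof.
have pE N : prod_partial N = expR (series (fun k => ln (1 + l k)) N).
  rewrite /prod_partial /series /= expR_sum; apply: eq_bigr => k _.
  by rewrite lnK // posrE ltr_wpDr.
set P := expR _.
have ln0 k : 0 <= ln (1 + l k) by rewrite ln_ge0 // lerDl.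
have pP N : prod_partial N <= P.
  by rewrite pE ler_expR; exact: nneg_series_le_lim ln1D_summable.
have cP : prod_partial @ \oo --> P.
  rewrite (_ : prod_partial = fun N => expR (series (fun k => ln (1 + l k)) N)); last exact/funext.
  by apply: (cvg_comp _ _ ln1D_summable); exact: continuous_expR.
rewrite /fredholm_det; apply: cvg_lim => //.
rewrite -/(fredholm_section).
apply/cvgrPdist_lt => e e0.
have /cvgrPdist_lt/(_ _ e0)[N _ /(_ N (leqnn N))/=] := cP.
rewrite ger0_norm ?subr_ge0 // => PN.
(* What is left of e once the product has been cut at N. *)
have e1 : 0 < e - (P - prod_partial N) by rewrite subr_gt0.
have /cvgrPdist_lt/(_ _ e1) := section_cvg_prod (N := N).
apply: filterS => n hn.
have le1 : \det (section n N) <= \det (fredholm_section n).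
  rewrite -(cvg_lim _ (section_cvg (n := n))) //; apply: nondecreasing_cvgn_le; first exact: section_mono.
  by apply/cvg_ex; eexists; exact: section_cvg.
have le2 : \det (fredholm_section n) <= P.
  rewrite -(cvg_lim _ (section_cvg (n := n))) //; apply: limr_le.
    by apply/cvg_ex; eexists; exact: section_cvg.
  by apply: nearW => N'; have [_ _ h] := section_bounds n N'; exact: le_trans (pP N').
rewrite -/(fredholm_section n) ger0_norm ?subr_ge0 //.
by move: hn => /(le_lt_trans (ler_norm _)); lra.
Qed.

End FredholmDeterminant.

(** * The Bregman divergence of ln cosh *)

Section LogCosh.
Context {R : realType}.
Implicit Types (x y z : R).

Definition cosh x := (expR x + expR (- x)) / 2.
Definition tanh x := (expR x - expR (- x)) / (expR x + expR (- x)).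
Definition lncosh x := ln (cosh x).

Definition lncosh_bregman x y := lncosh x - lncosh y - tanh y * (x - y).

Lemma cosh_gt0 x : 0 < cosh x.
Proof. by rewrite divr_gt0 // addr_gt0 // expR_gt0. Qed.

Lemma lncoshN x : lncosh (- x) = lncosh x.
Proof. by rewrite /lncosh /cosh opprK addrC. Qed.

Lemma tanhN x : tanh (- x) = - tanh x.
Proof. by rewrite /tanh opprK -mulNr opprB (addrC (expR x)). Qed.

Lemma lncosh0 : lncosh 0 = 0.
Proof. by rewrite /lncosh /cosh oppr0 expR0 -mulr2n -(mulr_natr 1) mul1r divff // ln1. Qed.

Lemma tanh0 : tanh 0 = 0.
Proof. by rewrite /tanh oppr0 subrr mul0r. Qed.

Lemma lncosh_bregmanN x y : lncosh_bregman (- x) (- y) = lncosh_bregman x y.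
Proof. by rewrite /lncosh_bregman !lncoshN tanhN; ring. Qed.

Lemma lncosh_bregmanx0 x : lncosh_bregman x 0 = lncosh x.
Proof. by rewrite /lncosh_bregman tanh0 lncosh0 mul0r !subr0. Qed.

Lemma is_derive_expRN x : is_derive x 1 (fun z => expR (- z)) (- expR (- x)).
Proof.
have h := is_derive1_comp (is_derive_expR (- x)) (is_deriveNid x 1).
by apply: (is_derive_eq h); rewrite mulrN1.
Qed.

Lemma tanh_sqr x : 1 - tanh x ^+ 2 = 4 / (expR x + expR (- x)) ^+ 2.
Proof.
have e0 : expR x + expR (- x) != 0 by rewrite gt_eqF // addr_gt0 ?expR_gt0.
have ee : expR x * expR (- x) = 1 by rewrite -expRD subrr expR0.
rewrite /tanh exprMn exprVn -[X in X - _](mulfV (expf_neq0 2 e0)) -mulrBl; congr (_ / _).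
rewrite subr_sqr; transitivity (4 * (expR x * expR (- x))); first by ring.
by rewrite ee mulr1.
Qed.

Lemma is_derive_lncosh x : is_derive x 1 lncosh (tanh x).
Proof.
have dN := is_derive_expRN x.
have dc : is_derive x 1 cosh ((expR x - expR (- x)) / 2).
  have h : is_derive x 1 (fun z => 2^-1 *: (expR z + expR (- z))) (2^-1 *: (expR x + - expR (- x))).
    by apply: is_deriveZ.
  rewrite (_ : cosh = fun z => 2^-1 *: (expR z + expR (- z))); last by apply/funext => z; rewrite /cosh mulrC.
  by apply: (is_derive_eq h); rewrite mulrC.
have dl : is_derive (cosh x) 1 (@ln R) (cosh x)^-1 by apply: is_derive1_ln; exact: cosh_gt0.
have h := is_derive1_comp dl dc.
apply: (is_derive_eq h).
rewrite /tanh /cosh.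
have e0 : expR x + expR (- x) != 0 by rewrite gt_eqF // addr_gt0 ?expR_gt0.
by field.
Qed.

Lemma is_derive_tanh x : is_derive x 1 tanh (1 - tanh x ^+ 2).
Proof.
have dN := is_derive_expRN x.
have e0 : expR x + expR (- x) != 0 by rewrite gt_eqF // addr_gt0 ?expR_gt0.
have dn : is_derive x 1 (fun z => expR z - expR (- z)) (expR x + expR (- x)).
  have h := is_deriveB (is_derive_expR x) dN.
  by apply: (is_derive_eq h); rewrite opprK.
have dd : is_derive x 1 (fun z => expR z + expR (- z)) (expR x - expR (- x)).
  exact: is_deriveD (is_derive_expR x) dN.
have dv : is_derive x 1 (fun z => (expR z + expR (- z))^-1) (- (expR x + expR (- x)) ^- 2 *: (expR x - expR (- x))).
  by apply: is_deriveV.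
have h := is_deriveM dn dv.
apply: (is_derive_eq h); rewrite /GRing.scale /= /tanh.
by field.
Qed.

Lemma norm_le_max x y z : x < z -> z < y -> `|z| <= Num.max `|x| `|y|.
Proof.
move=> xz zy; rewrite le_max; have [z0|z0] := leP 0 z.
  by rewrite ger0_norm //; apply/orP; right; apply: le_trans (ltW zy) (ler_norm _).
rewrite ltr0_norm //; apply/orP; left; rewrite -normrN.
by apply: le_trans (ler_norm _); rewrite lerN2 ltW.
Qed.

(** The mean value theorem without an order between x and y, keeping only what can be iterated: the
    size of c and the sign of (c - y) (x - y), strict for the equality case. *)
Lemma mvt_between (f df : R -> R) x y : (forall z, is_derive z 1 f (df z)) ->
  exists c, [/\ `|c| <= Num.max `|x| `|y|, 0 <= (c - y) * (x - y),
    x <> y -> 0 < (c - y) * (x - y) & f x - f y = df c * (x - y)].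
Proof.
move=> fd.
have cf a b : {within `[a, b], continuous f}.
  apply: derivable_within_continuous => z _.
  by have [] := fd z.
have [xy|yx|->] := ltgtP x y; last first.
- by exists y; rewrite !subrr !mulr0 maxxx lexx; split.
- have [c cyx e] := MVT yx (fun z _ => fd z) (cf y x).
  move: cyx; rewrite in_itv /= => /andP[yc cx].
  exists c; split=> //.
  + by rewrite maxC; exact: norm_le_max.
  + by rewrite mulr_ge0 // subr_ge0 ltW.
  + by move=> _; rewrite mulr_gt0 // subr_gt0.
- have [c cxy e] := MVT xy (fun z _ => fd z) (cf x y).
  move: cxy; rewrite in_itv /= => /andP[xc cy].
  exists c; split=> //.
  + exact: norm_le_max.
  + by rewrite -mulrNN mulr_ge0 // opprB subr_ge0 ltW.
  + by move=> _; rewrite -mulrNN mulr_gt0 // opprB subr_gt0.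
  + by rewrite -opprB e -mulrN opprB.
Qed.

Lemma norm_tanh_le x : `|tanh x| <= `|x|.
Proof.
have [c [_ _ _]] := mvt_between x 0 is_derive_tanh.
rewrite tanh0 !subr0 => ->; rewrite normrM -[leRHS]mul1r ler_wpM2r //.
have h : 0 <= 1 - tanh c ^+ 2 by rewrite tanh_sqr divr_ge0 // sqr_ge0.
by rewrite ger0_norm // gerBl sqr_ge0.
Qed.

(* The mean value theorem applied twice; [k = 0], [k = 1] and [k = 1 - M^2] give the
   positivity, the upper bound and the lower bound. *)
Lemma lncosh_bregman_expand k x y : exists c d, [/\ `|c| <= Num.max `|x| `|y|, 0 <= d,
  x <> y -> 0 < d & lncosh_bregman x y - k / 2 * (x - y) ^+ 2 = (1 - tanh c ^+ 2 - k) * d].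
Proof.
(* F' vanishes at y, so F'(c) is again an increment, from y to c; the second use of the theorem is
   for [tanh] there. *)
pose F z := lncosh z - tanh y *: z - (k / 2) *: (z - y) ^+ 2.
have dF z : is_derive z 1 F (tanh z - tanh y - k * (z - y)).
  have h1 := is_deriveZ (tanh y) (is_derive_id z (1 : R)).
  have h2 := is_deriveB (is_derive_lncosh z) h1.
  have h3 := is_deriveB (is_derive_id z (1 : R)) (is_derive_cst y z (1 : R)).
  have h4 := is_deriveZ (k / 2) (is_deriveX 2 h3).
  apply: (is_derive_eq (is_deriveB h2 h4)).
  rewrite (_ : (_ - _) z = z - y) // /GRing.scale /= subr0 expr1.
  by field.
have [c [cxy d0 dgt0 Fc]] := mvt_between x y dF.
have [c' [c'cy e0 egt0 tc]] := mvt_between c y is_derive_tanh.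
exists c', ((c - y) * (x - y)); split=> //.
  by apply: (le_trans c'cy); rewrite ge_max cxy le_max lexx orbT.
rewrite -[LHS](_ : F x - F y = _); last by rewrite /F /GRing.scale /= /lncosh_bregman subrr; ring.
by rewrite Fc tc; ring.
Qed.

Lemma lncosh_bregman_ge0 x y : 0 <= lncosh_bregman x y.
Proof.
have [c [d [_ d0 _]]] := lncosh_bregman_expand 0 x y.
rewrite !mul0r !subr0 => ->; rewrite mulr_ge0 // tanh_sqr divr_ge0 // sqr_ge0.
Qed.

Lemma lncosh_bregman_eq0 x y : lncosh_bregman x y = 0 -> x = y.
Proof.
have [c [d [_ _ dgt0]]] := lncosh_bregman_expand 0 x y.
rewrite !mul0r !subr0 => -> h; apply: contrapT => /dgt0 d0.
have : 0 < (1 - tanh c ^+ 2) * d.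
  by rewrite mulr_gt0 // tanh_sqr divr_gt0 // exprn_gt0 // addr_gt0 // expR_gt0.
by rewrite h ltxx.
Qed.

Lemma lncosh_bregman_le x y : lncosh_bregman x y <= (x - y) ^+ 2 / 2.
Proof.
have [c [d [_ d0 _]]] := lncosh_bregman_expand 1 x y.
move=> h; rewrite -subr_ge0 -oppr_le0 opprB (_ : _ - _ = lncosh_bregman x y - 1 / 2 * (x - y) ^+ 2); last by field.
by rewrite h mulr_le0_ge0 // (_ : 1 - _ - 1 = - tanh c ^+ 2) ?oppr_le0 ?sqr_ge0 //; ring.
Qed.

Lemma lncosh_bregman_ge M x y : `|x| <= M -> `|y| <= M ->
  (1 - M ^+ 2) / 2 * (x - y) ^+ 2 <= lncosh_bregman x y.
Proof.
move=> xM yM; have [c [d [cxy d0 _]]] := lncosh_bregman_expand (1 - M ^+ 2) x y.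
move=> h; rewrite -subr_ge0 h mulr_ge0 // (_ : _ - _ = M ^+ 2 - tanh c ^+ 2); last by ring.
have M0 : 0 <= M by apply: le_trans xM.
rewrite subr_ge0 -[leLHS]real_normK ?num_real // lerXn2r ?nnegrE //.
apply: le_trans (norm_tanh_le c) _; apply: (le_trans cxy).
by rewrite ge_max xM yM.
Qed.

End LogCosh.

(** * The divergence as a series *)

Section Divergence.
Context {R : realType} {H : realHilbertType R}.
Hypotheses (hsep : separable_space H) (hinf : infinite_dimensional H).
Implicit Types (A B : H -> H) (f : nat -> H) (u l : nat -> R) (a s g m t : R).

(** One-sided by ln (1 + h) <= h, then symmetrized. It carries square summability from the
    eigenvalues to their logarithms. *)
Lemma norm_ln_sub_le c x y : 0 < c -> c <= x -> c <= y -> `|ln x - ln y| <= `|x - y| / c :> R.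
Proof.
move=> c0.
have h (x' y' : R) : c <= x' -> c <= y' -> ln x' - ln y' <= `|x' - y'| / c.
  move=> cx cy; have x0 : 0 < x' := lt_le_trans c0 cx; have y0 : 0 < y' := lt_le_trans c0 cy.
  rewrite -ln_div ?posrE // (_ : x' / y' = 1 + (x' - y') / y'); last by field; rewrite gt_eqF.
  apply: (@le_trans _ _ ((x' - y') / y')).
    apply: le_ln1Dx; rewrite ltr_pdivlMr // mulN1r; lra.
  apply: (@le_trans _ _ (`|x' - y'| / y')).
    by rewrite ler_wpM2r ?invr_ge0 ?(ltW y0) // ler_norm.
  by rewrite ler_wpM2l // lef_pV2 ?posrE.
move=> cx cy; rewrite ler_norml lerNl opprB (distrC x y) h //=.
by rewrite distrC h.
Qed.

Lemma pd_spectrum_ln_summable t l : 0 < t -> pd_spectrum t l ->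
  cvgn (series (fun k => (ln (l k) - ln t) ^+ 2)).
Proof.
move=> t0 [[c [C [c0 lcC]]] hl].
pose d := Num.min c t; have d0 : 0 < d by rewrite lt_min c0.
have h : cvgn (series (d ^- 2 \*: (fun k => (l k - t) ^+ 2))) by apply: is_cvg_seriesZ.
apply: series_le_cvg h => k; rewrite ?sqr_ge0 //=.
  by rewrite /GRing.scale /= mulr_ge0 ?invr_ge0 ?sqr_ge0.
rewrite -[leLHS]real_normK ?num_real //.
have /andP[cl _] := lcC k.
have dl : d <= l k by rewrite ge_min cl.
have dt : d <= t by rewrite ge_min lexx orbT.
have := norm_ln_sub_le d0 dl dt.
rewrite -(@ler_pXn2r _ 2) ?nnegrE ?divr_ge0 ?(ltW d0) // => /le_trans; apply.
by rewrite exprMn exprVn real_normK ?num_real // mulrC.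
Qed.

Lemma bregman_summable a s u : cvgn (series (fun k => (u k - s) ^+ 2)) ->
  cvgn (series (fun k => lncosh_bregman (a * u k) (a * s))).
Proof.
move=> hu; have h : cvgn (series ((a ^+ 2 / 2) \*: (fun k => (u k - s) ^+ 2))).
  by apply: is_cvg_seriesZ.
apply: series_le_cvg h => k; first exact: lncosh_bregman_ge0.
  by rewrite /GRing.scale /= mulr_ge0 ?sqr_ge0 // divr_ge0 ?sqr_ge0.
apply: le_trans (lncosh_bregman_le _ _) _; rewrite -mulrBr exprMn /GRing.scale /=.
by rewrite mulrAC.
Qed.

Definition divergence_series a s u : R :=
  (a ^+ 2)^-1 * (lncosh (a * s) + limn (series (fun k => lncosh_bregman (a * u k) (a * s)))).

(** The weight is the logistic function at 2 x with x = a ln (g / m), and this is (1 + tanh x) /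
    2. *)
Lemma delta_tanh a g m : 0 < a -> 0 < g -> 0 < m ->
  a * g `^ (2 * a) / (a * g `^ (2 * a) + a * m `^ (2 * a)) =
  (1 + tanh (a * ln (g / m))) / 2.
Proof.
move=> a0 g0 m0; rewrite ln_div ?posrE // /powR !gt_eqF // /tanh.
rewrite mulrBr opprB !expRB.
have e2 x : expR (2 * a * x) = expR (a * x) ^+ 2 by rewrite -expRM_natl; congr expR; ring.
rewrite !e2.
move: (expR_gt0 (a * ln g)) (expR_gt0 (a * ln m)).
move: (expR _) (expR _) => E F E0 F0.
have n1 : E ^+ 2 + F ^+ 2 != 0 by rewrite gt_eqF // addr_gt0 // exprn_gt0.
have n2 : F ^+ 2 + E ^+ 2 != 0 by rewrite addrC.
have nE : E != 0 by rewrite gt_eqF.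
have nF : F != 0 by rewrite gt_eqF.
have na : a != 0 by rewrite gt_eqF.
rewrite -mulrDr.
have -> : (F / E - E / F) / (F / E + E / F) = (F ^+ 2 - E ^+ 2) / (F ^+ 2 + E ^+ 2).
  have nn : F * F + E * E != 0 by rewrite -!expr2.
  by field; rewrite nn nE nF.
by field; rewrite n2 na.
Qed.

(** With y = a ln x, the two exponentials are exp ((1 - T) y) and exp (- (1 + T) y); the common
    factor exp (- T y) leaves cosh y. *)
Lemma mean_eigenvalue a T x : 0 < a -> 0 < x ->
  (a + a)^-1 * (a * x `^ (2 * a * (1 - (1 + T) / 2)) + a * x `^ (- (2 * a * ((1 + T) / 2)))) =
  expR (lncosh (a * ln x) - T * (a * ln x)).
Proof.
move=> a0 x0; rewrite /powR gt_eqF // expRB /lncosh lnK ?posrE ?cosh_gt0 // -[RHS]mulrC -expRN.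
have -> : 2 * a * (1 - (1 + T) / 2) * ln x = - (T * (a * ln x)) + a * ln x by field.
have -> : - (2 * a * ((1 + T) / 2)) * ln x = - (T * (a * ln x)) - a * ln x by field.
rewrite !expRD /cosh; field.
by rewrite gt_eqF // addr_gt0.
Qed.

Lemma ab_divergence_formula a A g B m f l : 0 < a -> PC2 A g -> PC2 B m ->
  eigenbasis (relative_op A g B m) (f, l) ->
  ab_divergence a a (2 * a) A g B m = divergence_series a (ln (g / m)) (fun k => ln (l k)).
Proof.
move=> a0 pA pB fl; have g0 := PC2_gt0 hsep hinf pA; have m0 := PC2_gt0 hsep hinf pB.
have [L pL LE] := relative_op_PC2 hsep hinf pA pB.
have t0 : 0 < g / m by rewrite divr_gt0.
have spl : pd_spectrum (g / m) l by apply: (PC2_spectrum hsep hinf pL (e := f)); rewrite -LE.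
have [[c0 [C [c00 lcC]]] _] := spl.
have l0 k : 0 < l k := pd_spectrum_gt0 k spl.
have [/= bf Lf] := fl.
have sL : self_adjoint (relative_op A g B m).
  by rewrite LE; apply: plus_scalar_self_adjoint; case: pL.
rewrite /ab_divergence delta_tanh //.
set s := ln (g / m); set T := tanh (a * s); set d := (1 + T) / 2.
have powE p : op_pow (relative_op A g B m) p = diag_op f (fun k => l k `^ p).
  exact: (op_pow_diag bf sL Lf c00 lcC).
have bpow p : bounded_coefs (fun k => l k `^ p) by exact: bounded_coefs_powR lcC.
(* The eigenvalue of the operator inside the determinant as a function of the logarithm of l_k; its
   scalar part will be psi s. *)
pose psi x := expR (lncosh (a * x) - T * (a * x)).
pose b k := lncosh_bregman (a * ln (l k)) (a * s).
have psiE k : psi (ln (l k)) = psi s * expR (b k).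
  rewrite /psi /b -expRD; congr expR; rewrite /lncosh_bregman -/T; ring.
have psi0 x : 0 < psi x by exact: expR_gt0.
have bpsi : bounded_coefs (fun k => psi (ln (l k))).
  have := bounded_coefsM (bounded_coefs_cst (a + a)^-1) (bounded_coefsB
    (bounded_coefsM (bounded_coefs_cst a) (bpow (2 * a * (1 - d))))
    (bounded_coefsM (bounded_coefs_cst (- a)) (bpow (- (2 * a * d))))).
  congr bounded_coefs; apply/funext => k.
  by rewrite mulNr opprK /d mean_eigenvalue.
rewrite !powE.
set Op := (X in detX X).
have OpE : Op = diag_op f (fun k => psi (ln (l k))).
  apply/funext => x; apply: (diag_op_unique bf) => // k.
  rewrite /Op hdotZr hdotDr !hdotZr !(diag_op_coord bf) //.
  by have := mean_eigenvalue T a0 (l0 k); rewrite -/d -/(psi (ln (l k))) => <-; ring.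
have b0 k : 0 <= b k by exact: lncosh_bregman_ge0.
have cb : cvgn (series b) by apply: bregman_summable; exact: pd_spectrum_ln_summable.
(* The eigenvalues of the operator divided by its scalar part, minus 1. *)
pose kap k := expR (b k) - 1.
have kap0 k : 0 <= kap k by rewrite subr_ge0 -expR0 ler_expR.
have ckap : cvgn (series kap).
  pose M := expR (limn (series b)).
  have h : cvgn (series (M \*: b)) by apply: is_cvg_seriesZ.
  apply: series_le_cvg h => k //; first by rewrite /GRing.scale /= mulr_ge0 // expR_ge0.
  (* From 1 - b <= exp (- b) one gets exp b - 1 <= b exp b. *)
  apply: (@le_trans _ _ (expR (b k) * b k)).
    have := expR_ge1Dx (- b k); rewrite expRN /kap.
    have e0 := expR_gt0 (b k); rewrite -(ler_pM2l e0) mulfV ?gt_eqF //; lra.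
  by rewrite /GRing.scale /= ler_wpM2r // ler_expR; exact: nneg_series_term_le_lim.
have ctr : cvgn (series (fun k => psi s * kap k)) by exact: (is_cvg_seriesZ (k := psi s) ckap).
have plusE c : plus_scalar (diag_op f (fun k => psi (ln (l k)))) (- c) = diag_op f (fun k => psi (ln (l k)) - c).
  apply/funext => x; apply: (diag_op_unique bf) => [|k].
    by apply: bounded_coefsB => //; exact: bounded_coefs_cst.
  by rewrite /plus_scalar hdotDr hdotZr (diag_op_coord bf) // mulrBl mulNr.
have scE : tr_scalar_part Op = psi s.
  apply: (tr_scalar_partE hsep hinf); rewrite OpE plusE.
  rewrite (_ : (fun k => _) = (fun k => psi s * kap k)); last by apply/funext => k; rewrite psiE /kap; ring.
  by apply: (diag_op_trace_class hsep hinf bf) => // k; rewrite mulr_ge0 // ltW.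
have detE : detX Op = psi s * expR (limn (series b)).
  rewrite /detX scE OpE plusE; congr (_ * _).
  rewrite (_ : (fun x => _) = diag_op f kap).
    rewrite (fredholm_det_diag hsep hinf bf kap0 ckap); congr (expR (limn (series _))).
    by apply/funext => k; rewrite /kap addrC subrK expRK.
  apply/funext => x; apply: (diag_op_unique bf) => [|k]; first exact: nneg_summable_bounded.
  rewrite hdotZr (diag_op_coord bf); last by apply: bounded_coefsB => //; exact: bounded_coefs_cst.
  by rewrite psiE /kap; field; rewrite gt_eqF.
rewrite detE /divergence_series -expr2; congr (_ * _).
(* The prefactor contributes 2 a (delta - 1/2) s = T a s, which cancels the linear term of ln (psi
   s) and leaves ln cosh (a s). *)
rewrite lnM ?posrE; [|exact: powR_gt0|by apply: mulr_gt0 => //; exact: expR_gt0].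
rewrite ln_powR [ln (psi s * _)]lnM ?posrE; [|exact: psi0|exact: expR_gt0].
rewrite /psi !expRK.
rewrite -/s addrA; congr (_ + _).
rewrite (_ : a / (a + a) = 2^-1); last first.
  by field; rewrite !gt_eqF // addr_gt0.
by rewrite /d -/T; field.
Qed.

End Divergence.

(** * The limit at alpha = 0, the equality case and symmetry *)

Section SymmetricDivergence.
Context {R : realType} {H : realHilbertType R}.
Hypotheses (hsep : separable_space H) (hinf : infinite_dimensional H).
Implicit Types (A B : H -> H) (f : nat -> H) (u l : nat -> R) (a s g m : R).

Lemma relative_op_spectrum A g B m f l : PC2 A g -> PC2 B m ->
  eigenbasis (relative_op A g B m) (f, l) ->
  self_adjoint (relative_op A g B m) /\ pd_spectrum (g / m) l.
Proof.
move=> pA pB; have [L pL ->] := relative_op_PC2 hsep hinf pA pB => fl.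
split; first by apply: plus_scalar_self_adjoint; case: pL.
exact: (PC2_spectrum hsep hinf pL fl).
Qed.

Lemma d_aiHS_formula A g B m f l : PC2 A g -> PC2 B m ->
  eigenbasis (relative_op A g B m) (f, l) ->
  d_aiHS A g B m ^+ 2 =
    ln (g / m) ^+ 2 + limn (series (fun k => (ln (l k) - ln (g / m)) ^+ 2)).
Proof.
move=> pA pB fl; have [sL spl] := relative_op_spectrum pA pB fl.
have t0 : 0 < g / m by rewrite divr_gt0 ?(PC2_gt0 hsep hinf pA) ?(PC2_gt0 hsep hinf pB).
have [[c [C [c0 lcC]]] _] := spl; have [/= bf Lf] := fl.
have bln := bounded_coefs_ln c0 lcC.
set s := ln (g / m).
have bls : bounded_coefs (fun k => ln (l k) - s).
  by apply: bounded_coefsB => //; exact: bounded_coefs_cst.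
rewrite /d_aiHS (op_log_diag bf sL Lf c0 lcC).
have plusE : plus_scalar (diag_op f (fun k => ln (l k))) (- s) = diag_op f (fun k => ln (l k) - s).
  apply/funext => x; apply: (diag_op_unique bf) => // k.
  by rewrite /plus_scalar hdotDr hdotZr (diag_op_coord bf) // mulrBl mulNr.
have sqE : (fun k => `|diag_op f (fun k => ln (l k) - s) (f k)| ^+ 2) = (fun k => (ln (l k) - s) ^+ 2).
  apply/funext => k; rewrite (diag_op_basis bf) // normrZ (orthonormal_norm _ (basis_orthonormal bf)) mulr1.
  by rewrite real_normK ?num_real.
have [|hs hsE] := hilbert_schmidt_basis hsep hinf bf (diag_op_bounded bf bls) (diag_op_self_adjoint bf bls).
  by rewrite sqE; exact: pd_spectrum_ln_summable.
rewrite /ehs_norm (hs_scalar_partE hsep hinf (g := s)) plusE // hsE sqE.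
have cls : cvgn (series (fun k => (ln (l k) - s) ^+ 2)) by exact: pd_spectrum_ln_summable.
rewrite sqr_sqrtr; first by rewrite addrC.
by rewrite addr_ge0 ?sqr_ge0 // nneg_series_lim_ge0 // => k; exact: sqr_ge0.
Qed.

Definition squared_distance_series s u : R :=
  s ^+ 2 + limn (series (fun k => (u k - s) ^+ 2)).

Lemma limn_seriesZ (v : R^nat) (c : R) : cvgn (series v) ->
  limn (series (fun k => c * v k)) = c * limn (series v).
Proof. by move=> cv; exact: (lim_seriesZ c cv). Qed.

(** Since |a u_k| and |a s| are at most a K, the Bregman bounds hold with constants independent of k
    and can be summed; a^-2 cancels the factor a^2 of the squares. *)
Lemma divergence_series_bounds s u K a : 0 < a ->
  `|s| <= K -> (forall k, `|u k| <= K) -> cvgn (series (fun k => (u k - s) ^+ 2)) ->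
  (1 - (a * K) ^+ 2) * (2^-1 * squared_distance_series s u) <= divergence_series a s u
    <= 2^-1 * squared_distance_series s u.
Proof.
move=> a0 sK uK cu.
have K0 : 0 <= K by apply: le_trans sK.
have scale x : `|x| <= K -> `|a * x| <= a * K.
  by move=> xK; rewrite normrM gtr0_norm // ler_pM2l.
have cb := bregman_summable (a := a) cu.
have cc c : cvgn (series (fun k => c * (u k - s) ^+ 2)) by exact: (is_cvg_seriesZ (k := c) cu).
have up : limn (series (fun k => lncosh_bregman (a * u k) (a * s))) <=
    a ^+ 2 / 2 * limn (series (fun k => (u k - s) ^+ 2)).
  rewrite -limn_seriesZ //; apply: lim_series_le => // k.
  by apply: le_trans (lncosh_bregman_le _ _) _; rewrite -mulrBr exprMn mulrAC.
have low : (1 - (a * K) ^+ 2) / 2 * a ^+ 2 * limn (series (fun k => (u k - s) ^+ 2)) <=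
    limn (series (fun k => lncosh_bregman (a * u k) (a * s))).
  rewrite -limn_seriesZ //; apply: lim_series_le => // k.
  apply: le_trans (lncosh_bregman_ge (scale _ (uK k)) (scale _ sK)).
  rewrite (_ : (a * u k - a * s) ^+ 2 = a ^+ 2 * (u k - s) ^+ 2); last by ring.
  by rewrite [leRHS]mulrA.
have up0 : lncosh (a * s) <= a ^+ 2 / 2 * s ^+ 2.
  have := lncosh_bregman_le (a * s) 0; rewrite lncosh_bregmanx0 subr0 exprMn.
  by rewrite mulrAC.
have low0 : (1 - (a * K) ^+ 2) / 2 * a ^+ 2 * s ^+ 2 <= lncosh (a * s).
  have := lncosh_bregman_ge (scale _ sK) (scale 0 _); rewrite mulr0 normr0 => /(_ K0).
  by rewrite lncosh_bregmanx0 subr0 [(a * s) ^+ 2]exprMn [leLHS]mulrA.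
have a2 : 0 < a ^+ 2 by rewrite exprn_gt0.
rewrite /divergence_series /squared_distance_series.
move: low up low0 up0; set D := limn _; set S := limn _ => low up low0 up0.
have VK x : a ^+ 2 * ((a ^+ 2)^-1 * x) = x by rewrite mulrA mulfV ?mul1r // gt_eqF.
by apply/andP; split; rewrite -(ler_pM2l a2) VK; lra.
Qed.

Lemma divergence_series_cvg s u : bounded_coefs u ->
  cvgn (series (fun k => (u k - s) ^+ 2)) ->
  divergence_series a s u @[a --> 0^'+] --> 2^-1 * squared_distance_series s u.
Proof.
move=> [K uK] cu; set E := 2^-1 * _.
pose K' := Num.max `|s| K.
have sK' : `|s| <= K' by rewrite le_max lexx.
have uK' k : `|u k| <= K' by rewrite le_max uK orbT.
apply: (@squeeze_cvgr _ _ _ _ (fun a => (1 - (a * K') ^+ 2) * E) (fun=> E)).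
- by near=> a; apply: divergence_series_bounds.
- apply: cvg_at_right_filter.
  have {2}-> : E = (1 - (0 * K') * (0 * K')) * E by rewrite !mul0r subr0 mul1r.
  under eq_fun do rewrite expr2.
  apply: cvgM; last exact: cvg_cst.
  apply: cvgB; first exact: cvg_cst.
  by apply: cvgM; apply: cvgM; (exact: cvg_id || exact: cvg_cst).
- exact: cvg_cst.
Unshelve. all: by end_near. Qed.

Lemma ab_divergence_cvg A g B m f l : PC2 A g -> PC2 B m ->
  eigenbasis (relative_op A g B m) (f, l) ->
  ab_divergence a a (2 * a) A g B m @[a --> 0^'+] -->
    2^-1 * squared_distance_series (ln (g / m)) (fun k => ln (l k)).
Proof.
move=> pA pB fl; have [_ spl] := relative_op_spectrum pA pB fl.
have t0 : 0 < g / m by rewrite divr_gt0 ?(PC2_gt0 hsep hinf pA) ?(PC2_gt0 hsep hinf pB).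
have [[c [C [c0 lcC]]] _] := spl.
have h := divergence_series_cvg (bounded_coefs_ln c0 lcC) (pd_spectrum_ln_summable t0 spl).
apply: cvg_trans h; apply: near_eq_cvg; near=> a.
by rewrite (ab_divergence_formula hsep hinf _ pA pB fl).
Unshelve. all: by end_near. Qed.

Definition sym_divergence_series a s u : R :=
  if a == 0 then 2^-1 * squared_distance_series s u else divergence_series a s u.

Lemma sym_divergence_formula a A g B m f l : 0 <= a -> PC2 A g -> PC2 B m ->
  eigenbasis (relative_op A g B m) (f, l) ->
  sym_divergence a A g B m = sym_divergence_series a (ln (g / m)) (fun k => ln (l k)).
Proof.
move=> a0 pA pB fl; rewrite /sym_divergence /sym_divergence_series.
case: eqVneq => [_|an0]; first by apply: cvg_lim => //; exact: (ab_divergence_cvg pA pB fl).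
by rewrite (ab_divergence_formula hsep hinf _ pA pB fl) // lt_def an0.
Qed.

Lemma sym_divergence_series_ge0 a s u : 0 <= a -> cvgn (series (fun k => (u k - s) ^+ 2)) ->
  0 <= sym_divergence_series a s u.
Proof.
move=> a0 cu; rewrite /sym_divergence_series; case: ifP => _.
  rewrite mulr_ge0 // addr_ge0 ?sqr_ge0 // nneg_series_lim_ge0 // => k; exact: sqr_ge0.
rewrite mulr_ge0 ?invr_ge0 ?sqr_ge0 // addr_ge0 //.
  by rewrite -lncosh_bregmanx0 lncosh_bregman_ge0.
by apply: nneg_series_lim_ge0 => [k|]; [exact: lncosh_bregman_ge0|exact: bregman_summable].
Qed.

(** Every term of a vanishing nonnegative sum vanishes: the one in s gives s = 0, after which the
    others give u_k = s = 0. *)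
Lemma sym_divergence_series_eq0 a s u : 0 <= a -> cvgn (series (fun k => (u k - s) ^+ 2)) ->
  sym_divergence_series a s u = 0 -> s = 0 /\ forall k, u k = 0.
Proof.
move=> a0 cu; rewrite /sym_divergence_series; case: eqVneq => [_|an0].
  move/eqP; rewrite mulf_eq0 invr_eq0 pnatr_eq0 /= paddr_eq0 ?sqr_ge0 //; last first.
    by rewrite nneg_series_lim_ge0 // => k; exact: sqr_ge0.
  rewrite sqrf_eq0 => /andP[/eqP s0 /eqP h]; split=> // k.
  have := nneg_series_lim_eq0 (fun k => sqr_ge0 (u k - s)) cu h k.
  by move/eqP; rewrite sqrf_eq0 s0 subr0 => /eqP.
have cb := bregman_summable (a := a) cu.
have b0 k : 0 <= lncosh_bregman (a * u k) (a * s) by exact: lncosh_bregman_ge0.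
move/eqP; rewrite mulf_eq0 invr_eq0 sqrf_eq0 (negbTE an0) /= paddr_eq0; last 2 first.
- by rewrite -lncosh_bregmanx0 lncosh_bregman_ge0.
- exact: nneg_series_lim_ge0.
move=> /andP[/eqP h1 /eqP h2].
have s0 : s = 0.
  have /lncosh_bregman_eq0/eqP : lncosh_bregman (a * s) 0 = 0 by rewrite lncosh_bregmanx0.
  by rewrite mulf_eq0 (negbTE an0) => /eqP.
split=> // k; have /lncosh_bregman_eq0/(mulfI an0) := nneg_series_lim_eq0 b0 cb h2 k.
by rewrite s0.
Qed.

Lemma sym_divergence_series0 a : sym_divergence_series a 0 (fun=> 0) = 0.
Proof.
have z0 : limn (series (fun _ : nat => 0 : R)) = 0.
  by apply: lim_near_cst => //; apply: nearW => n; rewrite /series /= big1.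
rewrite /sym_divergence_series; case: ifP => _.
  rewrite /squared_distance_series subr0 expr0n /= z0 addr0 mulr0 //.
by rewrite /divergence_series mulr0 lncosh0 lncosh_bregmanx0 lncosh0 z0 addr0 mulr0.
Qed.

Lemma sym_divergence_seriesN a s u :
  sym_divergence_series a (- s) (fun k => - u k) = sym_divergence_series a s u.
Proof.
rewrite /sym_divergence_series; case: ifP => _.
  rewrite /squared_distance_series sqrrN.
  by under eq_fun do rewrite -opprD sqrrN.
rewrite /divergence_series mulrN lncoshN.
by under eq_fun do rewrite mulrN lncosh_bregmanN.
Qed.

(** All eigenvalues equal to 1 means Q X Q = I; multiplying by S = Y^(1/2) on both sides gives X = S
    S = Y. *)
Lemma PC2_eq_relative_op A g B m f : PC2 A g -> PC2 B m ->
  eigenbasis (relative_op A g B m) (f, fun=> 1) -> plus_scalar A g = plus_scalar B m.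
Proof.
move=> pA pB fl; have [sL _] := relative_op_spectrum pA pB fl; have [/= bf Lf] := fl.
have LE := eigen_diag_op bf sL Lf (bounded_coefs_cst 1).
have L1 x : relative_op A g B m x = x.
  rewrite LE; apply/esym/(diag_op_unique bf) => [|k]; first exact: bounded_coefs_cst.
  by rewrite mul1r.
have [b [u bu]] := PC2_eigenbasis hsep hinf pB; have us := PC2_spectrum hsep hinf pB bu.
have [[c [C [c0 ucC]]] _] := us; have [/= bb Bb] := bu.
have sB : self_adjoint (plus_scalar B m) by apply: plus_scalar_self_adjoint; case: pB.
have YE := eigen_diag_op bb sB Bb (bounded_coefs_itv ucC).
have u0 k := pd_spectrum_gt0 k us.
have bs := bounded_coefs_powR (2^-1) c0 ucC.
have bq := bounded_coefs_powR (- 2^-1) c0 ucC.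
move: L1; rewrite /relative_op (op_pow_diag bb sB Bb c0 ucC) => L1.
set Q := diag_op b _ in L1; pose S := diag_op b (fun k => u k `^ (2^-1)).
have QS x : Q (S x) = x.
  rewrite /Q /S diag_opM //; apply/esym/(diag_op_unique bb) => [|k]; first exact: bounded_coefsM.
  by rewrite powRN mulVf ?mul1r // gt_eqF // powR_gt0.
have SQ x : S (Q x) = x.
  rewrite /Q /S diag_opM //; apply/esym/(diag_op_unique bb) => [|k]; first exact: bounded_coefsM.
  by rewrite powRN mulfV ?mul1r // gt_eqF // powR_gt0.
apply/funext => x; rewrite -[LHS]SQ -{1}[x]QS L1 YE.
by rewrite /S diag_opM //; congr diag_op; apply/funext => k; exact: powR2_sqr.
Qed.

Lemma relative_op_diag A g : PC2 A g -> forall x, relative_op A g A g x = x.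
Proof.
move=> pA x; have [b [u bu]] := PC2_eigenbasis hsep hinf pA; have us := PC2_spectrum hsep hinf pA bu.
have [[c [C [c0 ucC]]] _] := us; have [/= bb Bb] := bu.
have sA : self_adjoint (plus_scalar A g) by apply: plus_scalar_self_adjoint; case: pA.
have bu' := bounded_coefs_itv ucC.
have bq := bounded_coefs_powR (- 2^-1) c0 ucC.
rewrite /relative_op (op_pow_diag bb sA Bb c0 ucC) (eigen_diag_op bb sA Bb bu').
rewrite !diag_opM //; last exact: bounded_coefsM.
apply/esym/(diag_op_unique bb) => [|k]; first by do 2! apply: bounded_coefsM => //.
have u0 := pd_spectrum_gt0 k us.
by rewrite (mulrAC _ (u k)) powRN2_sqr // mulVf ?mul1r // gt_eqF.
Qed.

Lemma relative_op_eigenbasis A g B m : PC2 A g -> PC2 B m ->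
  exists f l, eigenbasis (relative_op A g B m) (f, l).
Proof.
move=> pA pB; have [L pL ->] := relative_op_PC2 hsep hinf pA pB.
exact: (PC2_eigenbasis hsep hinf pL).
Qed.

Lemma sym_divergence_eq0 a A g B m : 0 <= a -> PC2 A g -> PC2 B m ->
  sym_divergence a A g B m = 0 <-> A = B /\ g = m.
Proof.
move=> a0 pA pB; have [f [l fl]] := relative_op_eigenbasis pA pB.
have g0 := PC2_gt0 hsep hinf pA; have m0 := PC2_gt0 hsep hinf pB.
have [_ spl] := relative_op_spectrum pA pB fl.
have t0 : 0 < g / m by rewrite divr_gt0.
rewrite (sym_divergence_formula a0 pA pB fl); split=> [h|[AB gm]].
  have [s0 u0] := sym_divergence_series_eq0 a0 (pd_spectrum_ln_summable t0 spl) h.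
  have l1 : l = fun=> 1.
    by apply/funext => k; apply: ln_inj; rewrite ?posrE ?ln1 ?u0 ?(pd_spectrum_gt0 k spl).
  (* s = 0 identifies the scalar parts, so that A + g I = B + m I then gives A = B. *)
  have gm : g = m.
    have : g / m = 1 by apply: ln_inj; rewrite ?posrE ?ln1.
    by move/(congr1 ( *%R^~ m)); rewrite divfK ?mul1r // gt_eqF.
  split=> //; rewrite l1 in fl; have := PC2_eq_relative_op pA pB fl; rewrite gm => h'.
  apply/funext => x; have := congr1 (fun F => F x) h'; rewrite /plus_scalar.
  exact: addIr.
have [/= bf Lf] := fl.
have l1 k : l k = 1.
  have := Lf k; rewrite AB gm relative_op_diag // => /(congr1 (hdot (f k))).
  by rewrite hdotZr (basis_orthonormal bf) eqxx mulr1.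
rewrite gm divff ?gt_eqF // ln1 (_ : (fun k => _) = (fun=> 0)) ?sym_divergence_series0 //.
by apply/funext => k; rewrite l1 ln1.
Qed.

Lemma sym_divergenceC a A g B m : 0 <= a -> PC2 A g -> PC2 B m ->
  sym_divergence a A g B m = sym_divergence a B m A g.
Proof.
move=> a0 pA pB; have [f [l fl]] := relative_op_eigenbasis pA pB.
have g0 := PC2_gt0 hsep hinf pA; have m0 := PC2_gt0 hsep hinf pB.
have [_ spl] := relative_op_spectrum pA pB fl.
have l0 k := pd_spectrum_gt0 k spl.
have [f' fl'] := relative_op_swap_eigenbasis hsep hinf pA pB fl l0.
rewrite (sym_divergence_formula a0 pA pB fl) (sym_divergence_formula a0 pB pA fl').
rewrite -sym_divergence_seriesN; congr sym_divergence_series.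
  by rewrite !ln_div ?posrE // opprB.
by apply/funext => k; rewrite lnV ?posrE.
Qed.

End SymmetricDivergence.

(** For alpha = beta = 1/2 and r = 1 the factor 1 / (alpha beta) is 4, and everything under the
    logarithm coincides. *)
Lemma stein_ab_divergence (R : realType) (H : realHilbertType R) (A : H -> H) (g : R)
    (B : H -> H) (m : R) : 0 < g -> 0 < m ->
  stein_divergence A g B m = 4^-1 * ab_divergence 2^-1 2^-1 1 A g B m.
Proof.
move=> g0 m0; rewrite /stein_divergence /ab_divergence !powRr1 ?ltW //.
have h2 : 2^-1 + 2^-1 = 1 :> R by field.
have -> : 2^-1 * g / (2^-1 * g + 2^-1 * m) = g / (g + m).
  by field; rewrite gt_eqF // addr_gt0.
rewrite mulrA (_ : 4^-1 * _ = 1); last by field.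
rewrite mul1r h2 divr1 !mul1r; congr (ln (_ * detX _)).
by apply/funext => x; rewrite invr1 scale1r scalerDr.
Qed.

(** Convergence as alpha -> 0+ is asserted separately because [lim] has a value even where no limit
    exists; with it, the equation for alpha = 0 concerns a true limit. *)
Theorem theorem4 (R : realType) (H : realHilbertType R)
    (hsep : separable_space H) (hinf : infinite_dimensional H) :
  (forall (alpha : R) (A : H -> H) (g : R) (B : H -> H) (m : R),
     0 <= alpha -> PC2 A g -> PC2 B m ->
     [/\ 0 <= sym_divergence alpha A g B m,
         sym_divergence alpha A g B m = 0 <-> A = B /\ g = m &
         sym_divergence alpha A g B m = sym_divergence alpha B m A g]) /\
  (forall (A : H -> H) (g : R) (B : H -> H) (m : R),
     PC2 A g -> PC2 B m ->
     [/\ cvg (ab_divergence a a (2 * a) A g B m @[a --> 0^'+]),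
         sym_divergence 0 A g B m = 2^-1 * d_aiHS A g B m ^+ 2,
         sym_divergence 2^-1 A g B m = ab_divergence 2^-1 2^-1 1 A g B m &
         stein_divergence A g B m = 4^-1 * ab_divergence 2^-1 2^-1 1 A g B m]).
Proof.
split=> [alpha|] A g B m => [a0|] pA pB;
  have g0 := PC2_gt0 hsep hinf pA; have m0 := PC2_gt0 hsep hinf pB;
  have [f [l fl]] := relative_op_eigenbasis hsep hinf pA pB;
  have t0 : 0 < g / m by rewrite divr_gt0.
- have [_ spl] := relative_op_spectrum hsep hinf pA pB fl.
  split; [|exact: sym_divergence_eq0|exact: sym_divergenceC].
  rewrite (sym_divergence_formula hsep hinf a0 pA pB fl).
  by apply: sym_divergence_series_ge0 => //; exact: pd_spectrum_ln_summable.
- split; last exact: stein_ab_divergence.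
  + by apply/cvg_ex; eexists; exact: (ab_divergence_cvg hsep hinf pA pB fl).
  + rewrite (sym_divergence_formula hsep hinf (lexx 0) pA pB fl) /sym_divergence_series eqxx.
    by rewrite (d_aiHS_formula hsep hinf pA pB fl).
  + by rewrite /sym_divergence invr_eq0 pnatr_eq0 /= mulfV ?pnatr_eq0.
Qed.
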